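(* Let $(M^n,g,f)$, $n\ge3$, be a static vacuum system with $0<f<1$ or $f>1$ in $M$. Let $p_n:=2-\frac{1}{n-1}$. For $c,d,p\in\mathbb{R}$ with $p\neq 1$ define $F,G\colon[0,1)\cup(1,\infty)\to\mathbb{R}$ by $$F(t):=\frac{ct^2+d}{|1-t^2|^{\frac{(n-1)(p-1)}{n-2}-1}},\qquad G(t):=\frac{4\left(\frac{(n-1)(p-1)}{n-2}-1\right)F(t)}{(p-1)(1-t^2)}-\frac{4c}{(p-1)|1-t^2|^{\frac{(n-1)(p-1)}{n-2}-1}}.$$ Then for all $c,d,p\in\mathbb{R}$ with $p\ne1$, the generalized Robinson identity $$\|\nabla f\|^2\operatorname{div}\left(\frac{F(f)}{f}\|\nabla f\|^{p-3}\nabla\|\nabla f\|^2+G(f)\|\nabla f\|^{p-1}\nabla f\right)$$ $$=\|\nabla f\|^{p-3}F(f)\left[\frac{(n-2)^2f}{(n-1)^2}\|T\|^2+\frac{p-p_n}{2f}\left\|\nabla\|\nabla f\|^2+\frac{4(n-1)}{(n-2)}\frac{f\|\nabla f\|^2\nabla f}{1-f^2}\right\|^2\right]\qquad(\ast)$$ holds on $M\setminus\operatorname{Crit}f$. Moreover, if $p\ge3$, the divergence on the left-hand side of $(\ast)$ continuously extends to $\operatorname{Crit}f$ and $(\ast)$ holds on $M$. Furthermore, if $p\ge p_n$, it follows that $$\operatorname{div}\left(\frac{F(f)}{f}\|\nabla f\|^{p-3}\nabla\|\nabla f\|^2+G(f)\|\nabla f\|^{p-1}\nabla f\right)\ge0$$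 on $M\setminus\operatorname{Crit}f$ provided that $F(f)\ge0$.
   Context: A static vacuum system $(M^n,g,f)$, $n\ge3$, is a smooth connected Riemannian manifold $(M^n,g)$ with a smooth function $f\colon M\to(0,\infty)$ (the lapse function) satisfying $\nabla^2f=f\,\mathrm{Ric}$ and $\Delta f=0$ on $M$, where $\nabla^2$, $\Delta$, $\mathrm{Ric}$ are the Hessian, Laplacian and Ricci tensor of $g$. $\operatorname{Crit}f:=\{q\in M : \|\nabla f\|_q=0\}$ is the set of critical points of $f$. $\|\cdot\|$ (full contraction norm), $\nabla$ and $\operatorname{div}$ are the tensor norm, covariant derivative/gradient and divergence with respect to $g$. The $T$-tensor is the $(0,3)$-tensor $$T(X,Y,Z):=\frac{n-1}{n-2}\left(\mathrm{Ric}(X,Z)\nabla_Yf-\mathrm{Ric}(Y,Z)\nabla_Xf\right)-\frac{1}{n-2}\left(\mathrm{Ric}(X,\nabla f)g(Y,Z)-\mathrm{Ric}(Y,\nabla f)g(X,Z)\right)$$ for vector fields $X,Y,Z$ on $M$, where $\nabla_Xf=X(f)$. *)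

(* Defs.v *)
From HB Require Import structures.
From mathcomp Require Import all_boot all_order all_algebra.
From mathcomp Require Import all_classical all_reals all_analysis.
Set Implicit Arguments.
Unset Strict Implicit.
Unset Printing Implicit Defensive.
Import Order.TTheory GRing.Theory Num.Theory.
Import numFieldNormedType.Exports.
Local Open Scope classical_set_scope.
Local Open Scope ring_scope.

Definition pd (R : realType) (n : nat) (i : 'I_n) (u : 'rV[R]_n -> R)
    : 'rV[R]_n -> R :=
  fun x => 'D_(delta_mx ord0 i) u x.

(* C^infinity on an open set: all iterated partial derivatives exist and are
   continuous there. *)
Definition smooth_on (R : realType) (n : nat) (U : set 'rV[R]_n)
    (u : 'rV[R]_n -> R) : Prop :=
  forall (s : seq 'I_n) (x : 'rV[R]_n), U x ->
    {for x, continuous (foldr (@pd R n) u s)} /\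
    (forall i : 'I_n, derivable (foldr (@pd R n) u s) x (delta_mx ord0 i)).

(* [chart_map] and [chart_inv] are total functions; only their values on the
   open sets [chart_dom] and [chart_cod] matter. *)
Record chart (R : realType) (n : nat) (M : topologicalType) := Chart {
  chart_dom : set M;
  chart_cod : set 'rV[R]_n;
  chart_map : M -> 'rV[R]_n;
  chart_inv : 'rV[R]_n -> M;
  chart_dom_open : open chart_dom;
  chart_cod_open : open chart_cod;
  chart_map_cod : forall q, chart_dom q -> chart_cod (chart_map q);
  chart_inv_dom : forall x, chart_cod x -> chart_dom (chart_inv x);
  chart_mapK : forall q, chart_dom q -> chart_inv (chart_map q) = q;
  chart_invK : forall x, chart_cod x -> chart_map (chart_inv x) = x;
  chart_map_continuous : {within chart_dom, continuous chart_map};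
  chart_inv_continuous : {within chart_cod, continuous chart_inv} }.

Definition transition (R : realType) (n : nat) (M : topologicalType)
    (k k' : chart R n M) : 'rV[R]_n -> 'rV[R]_n :=
  fun x => chart_map k' (chart_inv k x).

Definition overlap (R : realType) (n : nat) (M : topologicalType)
    (k k' : chart R n M) : set 'rV[R]_n :=
  [set x | chart_cod k x /\ chart_dom k' (chart_inv k x)].

(* The atlas need not be maximal. *)
Record manifold (R : realType) (n : nat) := Manifold {
  carrier :> topologicalType;
  atlas : set (chart R n carrier);
  manifold_hausdorff : hausdorff_space carrier;
  manifold_second_countable : @second_countable carrier;
  atlas_cover : forall q : carrier, exists2 k, atlas k & chart_dom k q;
  atlas_smooth : forall k k', atlas k -> atlas k' -> forall r : 'I_n,
    smooth_on (overlap k k') (fun x => transition k k' x ord0 r) }.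

Definition smooth (R : realType) (n : nat) (M : manifold R n) (f : M -> R)
    : Prop :=
  forall k, @atlas R n M k -> smooth_on (chart_cod k) (f \o chart_inv k).

(* A Riemannian metric is given by its component matrices in the charts of the
   atlas, which obey the transformation law of (0,2)-tensors. *)
Record riem_metric (R : realType) (n : nat) (M : manifold R n) := RiemMetric {
  gmx :> chart R n M -> 'rV[R]_n -> 'M[R]_n;
  gmx_smooth : forall k, atlas k -> forall i j : 'I_n,
    smooth_on (chart_cod k) (fun x => gmx k x i j);
  gmx_sym : forall k x, atlas k -> chart_cod k x -> (gmx k x)^T = gmx k x;
  gmx_posdef : forall k x, atlas k -> chart_cod k x -> forall v : 'rV[R]_n,
    v != 0 -> 0 < (v *m gmx k x *m v^T) ord0 ord0;
  gmx_transition : forall k k' x, atlas k -> atlas k' -> overlap k k' x ->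
    forall a b : 'I_n,
    gmx k x a b =
      \sum_r \sum_s pd a (fun y => transition k k' y ord0 r) x
                    * pd b (fun y => transition k k' y ord0 s) x
                    * gmx k' (transition k k' x) r s }.

(* Riemannian geometry in one chart: [g] is the matrix of metric components,
   functions and vector fields are given in the coordinates of the chart. *)
Section Coordinates.
Variables (R : realType) (n : nat) (g : 'rV[R]_n -> 'M[R]_n).
Implicit Types (u : 'rV[R]_n -> R) (x v w : 'rV[R]_n) (i j k l m : 'I_n).

Definition ginv i j x : R := invmx (g x) i j.

Definition inner x v w : R := (v *m g x *m w^T) ord0 ord0.

Definition sqnorm x v : R := inner x v v.

(* Gamma^k_{ij} *)
Definition christoffel k i j x : R :=
  2^-1 * \sum_l ginv k l x *
    (pd i (fun y => g y j l) x + pd j (fun y => g y i l) x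
     - pd l (fun y => g y i j) x).

Definition grad u x : 'rV[R]_n := \row_i \sum_j ginv i j x * pd j u x.

Definition norm_grad u x : R := Num.sqrt (sqnorm x (grad u x)).

Definition hessian u i j x : R :=
  pd i (pd j u) x - \sum_k christoffel k i j x * pd k u x.

Definition laplacian u x : R := \sum_i \sum_j ginv i j x * hessian u i j x.

(* the trace of the covariant derivative of X *)
Definition divergence (X : 'rV[R]_n -> 'rV[R]_n) x : R :=
  \sum_i (pd i (fun y => X y ord0 i) x
          + \sum_j christoffel i i j x * X x ord0 j).

(* d_l-component of R(d_i, d_j) d_k, where
   R(X, Y)Z = D_X D_Y Z - D_Y D_X Z - D_[X,Y] Z *)
Definition riemann l i j k x : R :=
  pd i (christoffel l j k) x - pd j (christoffel l i k) x
  + \sum_m (christoffel l i m x * christoffel m j k x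
            - christoffel l j m x * christoffel m i k x).

(* Ric(Y, Z) is the trace of X |-> R(X, Y)Z, hence positive on round spheres *)
Definition ricci_comp j k x : R := \sum_i riemann i i j k x.

Definition ricci x v w : R :=
  \sum_i \sum_j v ord0 i * w ord0 j * ricci_comp i j x.

Definition Ttensor u x (X Y Z : 'rV[R]_n) : R :=
  (n%:R - 1) / (n%:R - 2)
    * (ricci x X Z * 'D_Y u x - ricci x Y Z * 'D_X u x)
  - (n%:R - 2)^-1
    * (ricci x X (grad u x) * inner x Y Z - ricci x Y (grad u x) * inner x X Z).

Definition sqnorm3 (t : 'rV[R]_n -> 'rV[R]_n -> 'rV[R]_n -> R) x : R :=
  let e i : 'rV[R]_n := delta_mx ord0 i in
  \sum_i \sum_j \sum_k \sum_a \sum_b \sum_c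
    ginv i a x * ginv j b x * ginv k c x
    * t (e i) (e j) (e k) * t (e a) (e b) (e c).

End Coordinates.

Record static_vacuum (R : realType) (n : nat) (M : manifold R n)
    (g : riem_metric M) (f : M -> R) : Prop := StaticVacuum {
  sv_connected : connected [set: M];
  sv_smooth : smooth f;
  sv_pos : forall q, 0 < f q;
  sv_hessian : forall (k : chart R n M) x, atlas k -> chart_cod k x ->
    forall i j : 'I_n,
    hessian (g k) (f \o chart_inv k) i j x
      = (f \o chart_inv k) x * ricci_comp (g k) i j x;
  sv_harmonic : forall (k : chart R n M) x, atlas k -> chart_cod k x ->
    laplacian (g k) (f \o chart_inv k) x = 0 }.

(* Whether the gradient vanishes does not depend on the chart. *)
Definition Crit (R : realType) (n : nat) (M : manifold R n) (g : riem_metric M)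
    (f : M -> R) : set M :=
  [set q | exists k : chart R n M,
    [/\ atlas k, chart_dom k q
      & norm_grad (g k) (f \o chart_inv k) (chart_map k q) = 0]].

Section Robinson.
Variables (R : realType) (n : nat).
Implicit Types (c d p t : R).

Definition p_ : R := 2 - (n%:R - 1)^-1.

Definition robinson_exp p : R := (n%:R - 1) * (p - 1) / (n%:R - 2) - 1.

(* Only used at t in [0, 1) or (1, +oo); the value at t = 1 is junk. *)
Definition robF c d p t : R :=
  (c * t ^+ 2 + d) / `|1 - t ^+ 2| `^ robinson_exp p.

Definition robG c d p t : R :=
  4 * robinson_exp p * robF c d p t / ((p - 1) * (1 - t ^+ 2))
  - 4 * c / ((p - 1) * `|1 - t ^+ 2| `^ robinson_exp p).

Variables (g : 'rV[R]_n -> 'M[R]_n) (u : 'rV[R]_n -> R).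

(* Powers of the norm of the gradient are real powers [powR], for which
   [0 `^ 0 = 1] and [0 `^ a = 0] otherwise. *)
Definition robinson_field c d p (x : 'rV[R]_n) : 'rV[R]_n :=
  (robF c d p (u x) / u x * norm_grad g u x `^ (p - 3))
    *: grad g (fun y => norm_grad g u y ^+ 2) x
  + (robG c d p (u x) * norm_grad g u x `^ (p - 1)) *: grad g u x.

Definition robinson_rhs c d p (x : 'rV[R]_n) : R :=
  norm_grad g u x `^ (p - 3) * robF c d p (u x) *
  ((n%:R - 2) ^+ 2 * u x / (n%:R - 1) ^+ 2 * sqnorm3 g (Ttensor g u x) x
   + (p - p_) / (2 * u x)
     * sqnorm g x
         (grad g (fun y => norm_grad g u y ^+ 2) x
          + (4 * (n%:R - 1) / (n%:R - 2)
             * (u x * norm_grad g u x ^+ 2 / (1 - u x ^+ 2))) *: grad g u x)).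

End Robinson.
Arguments p_ {R} n.

(* Main.v *)
Require Import Defs.
From HB Require Import structures.
From mathcomp Require Import all_boot all_order all_algebra.
From mathcomp Require Import all_classical all_reals all_analysis.
From mathcomp Require Import ring lra.
Set Implicit Arguments.
Unset Strict Implicit.
Unset Printing Implicit Defensive.
Import Order.TTheory GRing.Theory Num.Theory.
Import numFieldNormedType.Exports.
Local Open Scope classical_set_scope.
Local Open Scope ring_scope.

(** Idea. Write W for the squared norm of the gradient of f, H for its Hessian
    and S for the inner product of the gradients of W and f. The identity
    div (D_v v) = tr ((D v)^2) + v (div v) + Ric (v, v) holds for every torsion
    free connection; for v = grad f it is Bochner's formula, and the static
    equations turn it into Delta W = 2 |H|^2 + S / f. Expanding T in an
    orthonormal frame (Ric = H / f, tr H = 0, grad W = 2 H (grad f)) gives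
      (n-2)^2 f / (n-1)^2 |T|^2
        = (2 W |H|^2 - n / (2 (n-1)) |grad W|^2) / f.
    The functions F and G are such that, with b the exponent [robinson_exp],
    F'/t + G (p-1)/2 = 4 b F / (1-t^2) and
    G' = 8 b (n-1)/(n-2) t F / (1-t^2)^2, so the divergence is the explicit
    expression [robinson_div], and ( * ) is algebra.
    For p >= 3 the same expression defines the extension to critical points: it
    is continuous there because |T|^2 >= 0 bounds |grad W|^2 by 4 W |H|^2, and
    it does not depend on the chart because all its ingredients are built from
    the inner products of gradients of functions. *)

(** The final algebra completes a square. In W times the bracket of [robinson_div] the term |grad
    W|^2 has coefficient (p-3)/(2f), while |T|^2 accounts for -n/(2(n-1)f) of it; the rest is
    (p-p_n)/(2f), because 3 - n/(n-1) = p_n. Also b = (n-1)(p-p_n)/(n-2), so the terms in S and in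
    W^3 are exactly the mixed and the last term of the square. This is where p_n and the factor
    4(n-1)/(n-2) come from. Smoothness is given as existence and continuity of iterated partial
    derivatives, so symmetry of mixed partials and the chain rule are derived from the mean value
    theorem. Tensor identities are index computations in one chart. Between charts only first
    derivatives of the transition map enter, since the Hessian is recovered from products of
    gradients; the inhomogeneous transformation law of the Christoffel symbols never appears. *)

(** * Algebra of smooth functions on an open set *)

Section SmoothFunctions.
Variables (R : realType) (n : nat).
Implicit Types (U : set 'rV[R]_n) (u v : 'rV[R]_n -> R) (x : 'rV[R]_n).

Local Notation e i := (delta_mx ord0 i : 'rV[R]_n).

Lemma pd_near u v x i : (\forall y \near x, u y = v y) -> pd i u x = pd i v x.
Proof. exact: near_eq_derive. Qed.

Lemma near_open U (Q : 'rV[R]_n -> Prop) x : open U -> U x ->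
  (forall y, U y -> Q y) -> \forall y \near x, Q y.
Proof.
move=> oU Ux UQ; apply: filterS UQ _; exact: open_nbhs_nbhs.
Qed.

Lemma pd_open_eq U u v x i : open U -> U x -> (forall y, U y -> u y = v y) ->
  pd i u x = pd i v x.
Proof. by move=> oU Ux uv; apply: pd_near; exact: near_open uv. Qed.

Lemma continuous_open_eq U u v x : open U -> U x ->
  (forall y, U y -> u y = v y) -> {for x, continuous u} -> {for x, continuous v}.
Proof.
move=> oU Ux uv cu; have vx : v x = u x by rewrite uv.
move: cu; rewrite /prop_for /continuous_at vx => cu.
apply: (@cvg_trans _ (u @ x)) cu.
by apply: (@near_eq_cvg _ _ (nbhs x) _ u v); exact: near_open uv.
Qed.

(** C^k on U. The recursion strips the innermost derivative and lowers the order, which suits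
    induction on k for products and reciprocals; [smooth_on] quantifies over whole words of
    derivatives instead. *)
Fixpoint cont_diff U (k : nat) u : Prop :=
  (forall x, U x -> {for x, continuous u}) /\
  if k is k'.+1 then
    (forall x i, U x -> derivable u x (e i)) /\
    (forall i, cont_diff U k' (pd i u))
  else True.

Lemma smooth_on_pd U u i : smooth_on U u -> smooth_on U (pd i u).
Proof. by move=> su s x Ux; have := su (rcons s i) x Ux; rewrite foldr_rcons. Qed.

Lemma smooth_on_continuous U u x : smooth_on U u -> U x ->
  {for x, continuous u}.
Proof. by move=> su Ux; have [] := su [::] x Ux. Qed.

Lemma smooth_on_derivable U u x i : smooth_on U u -> U x ->
  derivable u x (e i).
Proof. by move=> su Ux; have [_] := su [::] x Ux; apply. Qed.

Lemma smooth_onP U u : smooth_on U u <-> forall k, cont_diff U k u.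
Proof.
split=> [su k|].
  elim: k u su => [|k IH] u su /=.
    by split=> // x; exact: smooth_on_continuous.
  split; first by move=> x; exact: smooth_on_continuous.
  by split=> [x i|i]; [exact: smooth_on_derivable|exact/IH/smooth_on_pd].
(* [foldr] applies the last letter of the word first, so letters are removed from the end. *)
move=> cu s; elim/last_ind: s u cu => [|s i IH] u cu x Ux.
  by have [cu1 [cu2 _]] := cu 1%N; split=> [|i]; [exact: cu1|exact: cu2].
rewrite foldr_rcons; apply: IH => // k.
by have [_ [_ +]] := cu k.+1; exact.
Qed.

Lemma cont_diff_eq U k u v : open U -> (forall x, U x -> u x = v x) ->
  cont_diff U k u -> cont_diff U k v.
Proof.
move=> oU; elim: k u v => [|k IH] u v uv /= [cu du]; split=> //.
- by move=> x Ux; exact: (continuous_open_eq oU Ux uv (cu x Ux)).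
- by move=> x Ux; exact: (continuous_open_eq oU Ux uv (cu x Ux)).
- case: du => du ddu; split=> [x i Ux|i].
    by apply: (near_eq_derivable _ (du x i Ux)); exact: near_open uv.
  by apply: (IH _ _ _ (ddu i)) => x Ux; exact: pd_open_eq uv.
Qed.

Lemma smooth_on_eq U u v : open U -> (forall x, U x -> u x = v x) ->
  smooth_on U u -> smooth_on U v.
Proof.
by move=> oU uv /smooth_onP su; apply/smooth_onP => k; exact: cont_diff_eq (su k).
Qed.

Lemma smooth_on_subset U U' u : U `<=` U' -> smooth_on U' u -> smooth_on U u.
Proof. by move=> UU' su s x /UU'; exact: su. Qed.

Lemma cont_diffW U k u : cont_diff U k.+1 u -> cont_diff U k u.
Proof.
elim: k u => [|k IH] u /=; first by case.
by move=> [cu [du ddu]]; split=> //; split=> // i; exact/IH/ddu.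
Qed.

Lemma pd_cst (a : R) i : pd i (fun=> a) = (fun _ : 'rV[R]_n => 0).
Proof. by apply/funext => x; exact: derive_cst. Qed.

Lemma smooth_on_cst U (a : R) : smooth_on U (fun _ : 'rV[R]_n => a).
Proof.
apply/smooth_onP => k; elim: k a => [|k IH] a /=.
  by split=> // x _; exact: cst_continuous.
split; first by move=> x _; exact: cst_continuous.
split=> [x i _|i]; first exact: derivable_cst.
by rewrite pd_cst.
Qed.

Lemma pdD u v x i : derivable u x (e i) -> derivable v x (e i) ->
  pd i (fun y => u y + v y) x = pd i u x + pd i v x.
Proof. exact: deriveD. Qed.

Lemma pdM u v x i : derivable u x (e i) -> derivable v x (e i) ->
  pd i (fun y => u y * v y) x = pd i u x * v x + u x * pd i v x.
Proof.
by move=> du dv; rewrite /pd (deriveM du dv) addrC; congr (_ + _); exact: mulrC.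
Qed.

Lemma pdZ (a : R) u x i : derivable u x (e i) ->
  pd i (fun y => a * u y) x = a * pd i u x.
Proof. exact: deriveZ. Qed.

Lemma pd_sum m (F : 'I_m -> 'rV[R]_n -> R) x i :
  (forall j, derivable (F j) x (e i)) ->
  pd i (fun y => \sum_j F j y) x = \sum_j pd i (F j) x.
Proof.
move=> dF; rewrite /pd -derive_sum//; congr (derive _ _ _).
by apply/funext => y; rewrite fct_sumE.
Qed.

Lemma derivable_sum_fun m (F : 'I_m -> 'rV[R]_n -> R) x i :
  (forall j, derivable (F j) x (e i)) ->
  derivable (fun y => \sum_j F j y) x (e i).
Proof.
move=> dF; have -> : (fun y => \sum_j F j y) = \sum_j F j.
  by apply/funext => y; rewrite fct_sumE.
exact: derivable_sum.
Qed.

Lemma derivableM_fun u v x i : derivable u x (e i) -> derivable v x (e i) ->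
  derivable (fun y => u y * v y) x (e i).
Proof. exact: derivableM. Qed.

Lemma derivableD_fun u v x i : derivable u x (e i) -> derivable v x (e i) ->
  derivable (fun y => u y + v y) x (e i).
Proof. exact: derivableD. Qed.

Lemma cont_diffD U k u v : open U -> cont_diff U k u -> cont_diff U k v ->
  cont_diff U k (fun y => u y + v y).
Proof.
move=> oU; elim: k u v => [|k IH] u v /= [cu du] [cv dv].
  by split=> // x Ux; apply: continuousD; [exact: cu|exact: cv].
split; first by move=> x Ux; apply: continuousD; [exact: cu|exact: cv].
case: du dv => du ddu [dv ddv]; split=> [x i Ux|i].
  by apply: derivableD_fun; [exact: du|exact: dv].
apply: (@cont_diff_eq U k (fun y => pd i u y + pd i v y)) => //.
  by move=> x Ux; rewrite pdD//; [exact: du|exact: dv].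
exact: IH.
Qed.

Lemma cont_diffM U k u v : open U -> cont_diff U k u -> cont_diff U k v ->
  cont_diff U k (fun y => u y * v y).
Proof.
move=> oU; elim: k u v => [|k IH] u v; first move=> /= [cu du] [cv dv].
  by split=> // x Ux; apply: continuousM; [exact: cu|exact: cv].
(* In u'v + uv' the factors that are not differentiated enter at order k. *)
move=> cdu cdv; have := cont_diffW cdv; have := cont_diffW cdu.
case: cdu => cu [du ddu]; case: cdv => cv [dv ddv] cdu cdv.
split; first by move=> x Ux; apply: continuousM; [exact: cu|exact: cv].
split=> [x i Ux|i].
  by apply: derivableM_fun; [exact: du|exact: dv].
apply: (@cont_diff_eq U k (fun y => pd i u y * v y + u y * pd i v y)) => //.
  by move=> x Ux; rewrite pdM//; [exact: du|exact: dv].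
apply: cont_diffD => //; apply: IH => //; [exact: ddu|exact: ddv].
Qed.

Lemma smooth_onD U u v : open U -> smooth_on U u -> smooth_on U v ->
  smooth_on U (fun y => u y + v y).
Proof.
by move=> oU /smooth_onP su /smooth_onP sv; apply/smooth_onP => k;
  exact: cont_diffD.
Qed.

Lemma smooth_onM U u v : open U -> smooth_on U u -> smooth_on U v ->
  smooth_on U (fun y => u y * v y).
Proof.
by move=> oU /smooth_onP su /smooth_onP sv; apply/smooth_onP => k;
  exact: cont_diffM.
Qed.

Lemma smooth_onN U u : open U -> smooth_on U u -> smooth_on U (fun y => - u y).
Proof.
move=> oU su; apply: (smooth_on_eq (u := fun y => -1 * u y)) => //.
  by move=> x _; rewrite mulN1r.
by apply: smooth_onM => //; exact: smooth_on_cst.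
Qed.

Lemma smooth_onB U u v : open U -> smooth_on U u -> smooth_on U v ->
  smooth_on U (fun y => u y - v y).
Proof. by move=> oU su sv; apply: smooth_onD => //; exact: smooth_onN. Qed.

Lemma smooth_on_sum U (I : finType) (Q : pred I) (F : I -> 'rV[R]_n -> R) :
  open U -> (forall j, smooth_on U (F j)) ->
  smooth_on U (fun y => \sum_(j | Q j) F j y).
Proof.
move=> oU sF; elim: (index_enum I) => [|j s IH].
  by apply: (smooth_on_eq oU _ (@smooth_on_cst U 0)) => x _; rewrite big_nil.
case: (boolP (Q j)) => Qj.
  by apply: (smooth_on_eq oU _ (smooth_onD oU (sF j) IH)) => x _; rewrite big_cons Qj.
by apply: (smooth_on_eq oU _ IH) => x _; rewrite big_cons (negbTE Qj).
Qed.

Lemma smooth_on_prod U (I : finType) (F : I -> 'rV[R]_n -> R) :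
  open U -> (forall j, smooth_on U (F j)) ->
  smooth_on U (fun y => \prod_j F j y).
Proof.
move=> oU sF; elim: (index_enum I) => [|j s IH].
  by apply: (smooth_on_eq oU _ (@smooth_on_cst U 1)) => x _; rewrite big_nil.
by apply: (smooth_on_eq oU _ (smooth_onM oU (sF j) IH)) => x _; rewrite big_cons.
Qed.

Lemma cont_diffV U k u : open U -> (forall x, U x -> u x != 0) ->
  cont_diff U k u -> cont_diff U k (fun y => (u y)^-1).
Proof.
move=> oU u0; elim: k => [|k IH] cdu.
  by case: cdu => cu _; split=> // x Ux; apply: continuousV; [exact: u0|exact: cu].
have cdV := IH (cont_diffW cdu).
case: cdu => cu [du ddu]; split.
  by move=> x Ux; apply: continuousV; [exact: u0|exact: cu].
split=> [x i Ux|i]; first by apply: derivableV; [exact: u0|exact: du].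
(* The derivative -u'/u^2 contains 1/u again, which is C^k by the induction hypothesis [cdV]. *)
pose w := fun y => (-1 * pd i u y) * ((u y)^-1 * (u y)^-1).
apply: (@cont_diff_eq U k w) => //.
  move=> x Ux; rewrite /w /pd deriveV//; [|exact: u0|exact: du].
  by rewrite /GRing.scale/= mulN1r mulNr mulrC -expr2 -exprVn mulNr.
apply: cont_diffM => //; last exact: cont_diffM.
apply: cont_diffM => //; last exact: ddu.
exact: (smooth_onP _ _).1 (@smooth_on_cst U (-1)) k.
Qed.

Lemma smooth_onV U u : open U -> (forall x, U x -> u x != 0) ->
  smooth_on U u -> smooth_on U (fun y => (u y)^-1).
Proof.
by move=> oU u0 /smooth_onP su; apply/smooth_onP => k; exact: cont_diffV.
Qed.

Lemma smooth_on_det U m (A : 'rV[R]_n -> 'M[R]_m) : open U ->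
  (forall i j, smooth_on U (fun y => A y i j)) ->
  smooth_on U (fun y => \det (A y)).
Proof.
move=> oU sA; apply: smooth_on_sum => // s; apply: smooth_onM => //.
  exact: smooth_on_cst.
by apply: smooth_on_prod.
Qed.

(** Cramer's rule: an entry of the inverse is a cofactor over the determinant, both polynomial in
    the entries. *)
Lemma smooth_on_invmx U m (A : 'rV[R]_n -> 'M[R]_m) i j : open U ->
  (forall x, U x -> A x \in unitmx) ->
  (forall i j, smooth_on U (fun y => A y i j)) ->
  smooth_on U (fun y => invmx (A y) i j).
Proof.
move=> oU uA sA.
apply: (smooth_on_eq (u := fun y => (\det (A y))^-1 * cofactor (A y) j i)) => //.
  by move=> x Ux; rewrite /invmx uA// !mxE.
apply: smooth_onM => //.
  apply: smooth_onV => //; last exact: smooth_on_det.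
  by move=> x /uA; rewrite unitmxE unitfE.
apply: smooth_onM => //; first exact: smooth_on_cst.
apply: smooth_on_det => // a b.
by apply: smooth_on_eq (sA (lift j a) (lift i b)) => // x _; rewrite !mxE.
Qed.

End SmoothFunctions.

(** * Mean value theorem along lines and symmetry of mixed partial derivatives *)

Section MeanValue.
Variables (R : realType) (n : nat).
Implicit Types (U : set 'rV[R]_n) (u v : 'rV[R]_n -> R) (x y w : 'rV[R]_n).

Local Notation e i := (delta_mx ord0 i : 'rV[R]_n).

(** Moves a directional derivative to the line through z, where one-variable calculus applies. *)
Lemma derive_line u z w : 'D_1 (fun h : R => u (h *: w + z)) 0 = 'D_w u z.
Proof.
rewrite /derive; set g1 := fun h => h^-1 *: _; set g2 := fun h => h^-1 *: _.
suff -> : g1 = g2 by [].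
by rewrite funeqE /g1 /g2 => h /=; rewrite addr0 scale0r add0r [_%:A]mulr1.
Qed.

Lemma is_derive_translate u x a w (du : R) : is_derive (x + a) w u du ->
  is_derive x w (fun y => u (y + a)) du.
Proof.
have E : (fun h : R => h^-1 *: ((u \o shift (x + a)) (h *: w) - u (x + a))) =
    (fun h : R => h^-1 *:
       (((fun y => u (y + a)) \o shift x) (h *: w) - u (x + a))).
  by apply/funext => h /=; rewrite addrA.
by case; rewrite /derivable /derive E => D Du; split.
Qed.

Lemma is_derive_compR (h f : R -> R) (t df dh : R) :
  is_derive t 1 f df -> is_derive (f t) 1 h dh ->
  is_derive t 1 (fun r => h (f r)) (dh * df).
Proof.
move=> [Df Ef] [Dh Eh]; split.
  have /derivable1_diffP Ff := Df; have /derivable1_diffP Fh := Dh.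
  exact: (derivable1_diffP (h \o f) t).2 (differentiable_comp Ff Fh).
by have := derive1_comp Df Dh; rewrite !derive1E Ef Eh.
Qed.

Lemma is_derive_comp1 (h : R -> R) u x w (du dh : R) :
  is_derive x w u du -> is_derive (u x) 1 h dh ->
  is_derive x w (fun y => h (u y)) (dh * du).
Proof.
move=> [Du Eu] dh'.
have H : is_derive (0 : R) 1 (fun r : R => u (r *: w + x)) du.
  by split; [exact: (derivable1P u x w).1|rewrite derive_line].
have [] := is_derive_compR H (h := h) (dh := dh).
  by rewrite scale0r add0r.
move=> D E; split; first exact: (derivable1P (fun y => h (u y)) x w).2.
exact: (etrans (esym (derive_line (fun y => h (u y)) x w)) E).
Qed.

Lemma is_derive_line u y w (s t : R) : derivable u (y + (t * s) *: w) w ->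
  is_derive t 1 (fun t : R => u (y + (t * s) *: w))
    (s * 'D_w u (y + (t * s) *: w)).
Proof.
move=> du; set z := y + _ in du *.
have dl : is_derive (0 : R) 1 (fun h : R => u (h *: w + z)) ('D_w u z).
  by split; [exact: (derivable1P u z w).1|rewrite derive_line].
have -> : (fun t : R => u (y + (t * s) *: w)) =
    (fun r => (fun h : R => u (h *: w + z)) ((r - t) * s)).
  by apply/funext => r /=; congr u; rewrite /z addrCA -scalerDl -mulrDl subrK.
have df : is_derive t 1 (fun r : R => (r - t) * s) s.
  rewrite (_ : (fun r => _) = s *: (id - cst t) :> (R -> R)); last first.
    by apply/funext => r; rewrite mulrC.
  by apply: is_derive_eq; rewrite subr0 [LHS]mulr1.
rewrite mulrC; apply: (@is_derive_compR (fun h : R => u (h *: w + z)) _ _ _ _ df).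
by rewrite subrr mul0r.
Qed.

(** The segment is parametrized by t in [0, 1] with s as a factor, so that s may have either
    sign. *)
Lemma mean_value_line u y w (s : R) :
  (forall t : R, 0 <= t <= 1 -> derivable u (y + (t * s) *: w) w) ->
  exists2 t : R, 0 <= t <= 1 &
    u (y + s *: w) - u y = s * 'D_w u (y + (t * s) *: w).
Proof.
move=> du.
pose phi (t : R) : R := u (y + (t * s) *: w).
pose dphi (t : R) : R := s * 'D_w u (y + (t * s) *: w).
have phi' (t : R) : t \in `[0, 1]%R -> is_derive t 1 phi (dphi t).
  by rewrite in_itv => t01; apply: is_derive_line; exact: du.
have phi'o (t : R) : t \in `]0, 1[%R -> is_derive t 1 phi (dphi t).
  by move=> t01; apply: phi'; apply: subset_itv_oo_cc t01.
have cphi : {within `[0, 1], continuous phi}.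
  by apply: derivable_within_continuous => t /phi' [].
have [t] := @MVT_segment R phi dphi 0 1 ler01 phi'o cphi.
rewrite in_itv /phi /dphi => t01.
rewrite mul0r scale0r addr0 mul1r subr0 mulr1 => ?.
by exists t.
Qed.

(** The second difference of u over a small square at x is an increment in direction i of an
    increment in direction j, and also the other way round. Two mean value theorems turn each
    reading into s^2 times a mixed partial at a point near x; continuity at x does the rest. *)
Lemma schwarz U u x i j : open U -> U x ->
  (forall y, U y -> derivable u y (e i)) ->
  (forall y, U y -> derivable u y (e j)) ->
  (forall y, U y -> derivable (pd i u) y (e j)) ->
  (forall y, U y -> derivable (pd j u) y (e i)) ->
  {for x, continuous (pd j (pd i u))} -> {for x, continuous (pd i (pd j u))} ->
  pd j (pd i u) x = pd i (pd j u) x.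
Proof.
move=> oU Ux dui duj duij duji cij cji.
apply/eqP; rewrite -subr_eq0 -normr_le0; apply/ler_addgt0Pl => eps eps0.
rewrite addr0.
have e20 : 0 < eps / 2 by rewrite divr_gt0.
have oUx : nbhs x U by exact: open_nbhs_nbhs.
have [d d0 Hd] : exists2 d : R, 0 < d & forall y, `|x - y| < d ->
   [/\ U y, `|pd j (pd i u) x - pd j (pd i u) y| < eps / 2
    & `|pd i (pd j u) x - pd i (pd j u) y| < eps / 2].
  move/cvgrPdist_lt : cij => /(_ _ e20) c1.
  move/cvgrPdist_lt : cji => /(_ _ e20) c2.
  have : \forall y \near x, [/\ U y, `|pd j (pd i u) x - pd j (pd i u) y| < eps / 2
    & `|pd i (pd j u) x - pd i (pd j u) y| < eps / 2].
    apply: filterS (filterI oUx (filterI c1 c2)) => y.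
    by case=> Uy [H1 H2]; split; [exact: Uy|exact: H1|exact: H2].
  move/nbhs_ballP => [d /= d0 Hd]; exists d => // y xy; apply: Hd.
  by rewrite -ball_normE.
(* The summand 1 keeps K positive, and the side s = d / (2K) keeps the whole square inside the ball
   of radius d. *)
pose K := 1 + `|e i| + `|e j|.
have K0 : 0 < K by rewrite /K -addrA ltr_wpDr// addr_ge0.
pose s := d / K / 2.
have s0 : 0 < s by rewrite !divr_gt0.
have sK : s * (`|e i| + `|e j|) < d.
  apply: (@lt_le_trans _ _ (s * K)).
    by rewrite ltr_pM2l// /K -addrA ltrDr.
  by rewrite /s mulrAC divfK ?gt_eqF//; lra.
have near_x (a b : R) : 0 <= a <= 1 -> 0 <= b <= 1 ->
    `|x - (x + (a * s) *: e i + (b * s) *: e j)| < d.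
  have nz (t : R) w : 0 <= t <= 1 -> `|(t * s) *: w| <= s * `|w|.
    move=> /andP[t0 t1]; rewrite normrZ (ger0_norm (mulr_ge0 t0 (ltW s0))).
    by rewrite ler_wpM2r// ler_piMl// ltW.
  move=> ha hb; rewrite -addrA opprD addNKr normrN.
  apply: le_lt_trans sK; apply: le_trans (ler_normD _ _) _.
  by rewrite mulrDr; apply: lerD; exact: nz.
have i0 : (0 : R) <= 0 <= (1 : R) by rewrite lexx ler01.
have i1 : (0 : R) <= 1 <= (1 : R) by rewrite lexx ler01.
have inU (a b : R) : 0 <= a <= 1 -> 0 <= b <= 1 ->
    U (x + (a * s) *: e i + (b * s) *: e j).
  by move=> ha hb; have [] := Hd _ (near_x _ _ ha hb).
have D1 : exists y, `|x - y| < d /\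
    u (x + s *: e i + s *: e j) - u (x + s *: e i) - (u (x + s *: e j) - u x)
     = s * (s * pd j (pd i u) y).
  (* The outer mean value is taken in direction i for the increment of u by s e_j, the inner one in
     direction j for [pd i u]. *)
  have diff1 (t : R) : 0 <= t <= 1 -> is_derive (x + (t * s) *: e i) (e i)
      (fun y => u (y + s *: e j) - u y)
      (pd i u (x + (t * s) *: e i + s *: e j) - pd i u (x + (t * s) *: e i)).
    move=> ht.
    have d1 : derivable u (x + (t * s) *: e i + s *: e j) (e i).
      by have := dui _ (inU t 1 ht i1); rewrite mul1r.
    have d2 : derivable u (x + (t * s) *: e i) (e i).
      by have := dui _ (inU t 0 ht i0); rewrite mul0r scale0r addr0.
    have d1' := is_derive_translate (derivableP d1).
    have d2' := derivableP d2.
    exact: (is_deriveB d1' d2').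
  have [t ht|a ha Ha] :=
    @mean_value_line (fun y => u (y + s *: e j) - u y) x (e i) s.
    by case: (diff1 t ht).
  have [t ht|b hb Hb] :=
    @mean_value_line (pd i u) (x + (a * s) *: e i) (e j) s.
    exact/duij/inU.
  exists (x + (a * s) *: e i + (b * s) *: e j); split; first exact: near_x.
  by rewrite -[pd j _ _]/('D_(e j) (pd i u) _) -Hb Ha; case: (diff1 a ha) => _ ->.
have D2 : exists y, `|x - y| < d /\
    u (x + s *: e i + s *: e j) - u (x + s *: e j) - (u (x + s *: e i) - u x)
     = s * (s * pd i (pd j u) y).
  have diff1 (t : R) : 0 <= t <= 1 -> is_derive (x + (t * s) *: e j) (e j)
      (fun y => u (y + s *: e i) - u y)
      (pd j u (x + (t * s) *: e j + s *: e i) - pd j u (x + (t * s) *: e j)).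
    move=> ht.
    have d1 : derivable u (x + (t * s) *: e j + s *: e i) (e j).
      by have := duj _ (inU 1 t i1 ht); rewrite mul1r addrAC.
    have d2 : derivable u (x + (t * s) *: e j) (e j).
      by have := duj _ (inU 0 t i0 ht); rewrite mul0r scale0r addr0.
    have d1' := is_derive_translate (derivableP d1).
    have d2' := derivableP d2.
    exact: (is_deriveB d1' d2').
  have [t ht|a ha Ha] :=
    @mean_value_line (fun y => u (y + s *: e i) - u y) x (e j) s.
    by case: (diff1 t ht).
  have [t ht|b hb Hb] :=
    @mean_value_line (pd j u) (x + (a * s) *: e j) (e i) s.
    by rewrite addrAC; exact/duji/inU.
  exists (x + (a * s) *: e j + (b * s) *: e i); split.
    by rewrite addrAC; exact: near_x.
  rewrite -[pd i _ _]/('D_(e i) (pd j u) _) -Hb.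
  by rewrite [x + _ + s *: e j]addrAC Ha; case: (diff1 a ha) => _ ->.
case: D1 => y1 [/Hd[_ H1 _] E1]; case: D2 => y2 [/Hd[_ _ H2] E2].
have E : pd j (pd i u) y1 = pd i (pd j u) y2.
  apply: (mulfI (lt0r_neq0 s0)); apply: (mulfI (lt0r_neq0 s0)).
  have swap (a b c1 c2 : R) : a - b - (c1 - c2) = a - c1 - (b - c2) by ring.
  exact: etrans (esym E1) (etrans (swap _ _ _ _) E2).
have close (a b b' c : R) : `|a - b| < eps / 2 -> `|c - b'| < eps / 2 ->
    b = b' -> `|a - c| <= eps.
  move=> ab cb' bb'; rewrite [leRHS]splitr.
  apply: le_trans (lerD (ltW ab) (ltW cb')).
  by rewrite bb' (distrC c) ler_distD.
exact: close H1 H2 E.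
Qed.

Lemma smooth_on_schwarz U u x i j : open U -> smooth_on U u -> U x ->
  pd i (pd j u) x = pd j (pd i u) x.
Proof.
move=> oU su Ux; apply: (schwarz oU Ux).
- by move=> y; exact: smooth_on_derivable su.
- by move=> y; exact: smooth_on_derivable su.
- by move=> y; apply: smooth_on_derivable; exact: smooth_on_pd.
- by move=> y; apply: smooth_on_derivable; exact: smooth_on_pd.
- by apply: smooth_on_continuous Ux; do 2 apply: smooth_on_pd.
- by apply: smooth_on_continuous Ux; do 2 apply: smooth_on_pd.
Qed.

End MeanValue.

(** * Continuous partial derivatives imply differentiability; the chain rule *)

Section ChainRule.
Variables (R : realType) (n : nat).
Implicit Types (U : set 'rV[R]_n) (u v : 'rV[R]_n -> R) (x y h : 'rV[R]_n).

Local Notation e i := (delta_mx ord0 i : 'rV[R]_n).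

Lemma row_norm_le h (a : R) : 0 <= a -> (forall j, `|h ord0 j| <= a) ->
  `|h| <= a.
Proof.
move=> a0 ha; rewrite [leLHS]/Num.Def.normr/= mx_normrE.
by apply: bigmax_le => // -[i j] _ /=; rewrite ord1.
Qed.

Lemma row_coord_le h j : `|h ord0 j| <= `|h|.
Proof.
rewrite [leRHS]/Num.Def.normr/= mx_normrE.
exact: (le_bigmax _ (fun i => `|h i.1 i.2|) (ord0, j)).
Qed.

(** The corners of the staircase from 0 to h that follows the coordinate axes one after the
    other. *)
Definition row_trunc k h : 'rV[R]_n :=
  \row_i (if (i < k)%N then h ord0 i else 0).

Lemma row_truncS h (j : 'I_n) :
  row_trunc j.+1 h = row_trunc j h + h ord0 j *: e j.
Proof.
apply/rowP => i; rewrite !mxE eqxx /= ltnS leq_eqVlt.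
have [->|ij] := eqVneq i j; first by rewrite eqxx ltnn add0r mulr1.
by rewrite (inj_eq val_inj) (negbTE ij) mulr0 addr0.
Qed.

(** The norm of a row vector is its largest absolute coordinate, so no point of the staircase lies
    farther out than h. *)
Lemma row_trunc_between h (j : 'I_n) (t : R) : 0 <= t <= 1 ->
  `|row_trunc j h + (t * h ord0 j) *: e j| <= `|h|.
Proof.
move=> /andP[t0 t1]; apply: row_norm_le => // i; rewrite !mxE eqxx /=.
have [->|ij] := eqVneq i j.
  rewrite ltnn add0r mulr1 normrM (ger0_norm t0).
  by apply: le_trans (row_coord_le h j); rewrite ler_piMl.
rewrite mulr0 addr0; case: ifP => _; first exact: row_coord_le.
by rewrite normr0.
Qed.

Definition dlin u x h : R := \sum_j h ord0 j * pd j u x.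

Lemma dlin_linear u x : linear (dlin u x).
Proof.
move=> a h k; rewrite /dlin scaler_sumr -big_split /=; apply: eq_bigr => j _.
by rewrite !mxE mulrDl -mulrA.
Qed.

Lemma dlin_continuous u x : continuous (dlin u x).
Proof.
rewrite /dlin => h; elim: (index_enum 'I_n) => [|j s IH].
  under [X in continuous_at _ X]eq_fun do rewrite big_nil.
  exact: cst_continuous.
under [X in continuous_at _ X]eq_fun do rewrite big_cons.
apply: continuousD IH; apply: continuousM; first exact: coord_continuous.
exact: cst_continuous.
Qed.

(** Telescoping along the staircase leaves one mean value step per axis, and each step evaluates a
    partial derivative at a point closer than d to x. *)
Lemma increment_bound U u x (d eps : R) : 0 < d ->
  (forall y, `|x - y| < d -> U y) ->
  (forall y i, U y -> derivable u y (e i)) ->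
  (forall y i, `|x - y| < d -> `|pd i u y - pd i u x| <= eps) ->
  forall h, `|h| < d -> `|u (x + h) - u x - dlin u x h| <= n%:R * (eps * `|h|).
Proof.
move=> d0 dU du cu h hd.
have tail : u (x + h) - u x =
    \sum_(j < n) (u (x + row_trunc j.+1 h) - u (x + row_trunc j h)).
  rewrite -(big_mkord xpredT
    (fun k => u (x + row_trunc k.+1 h) - u (x + row_trunc k h))).
  rewrite telescope_sumr//; congr (u _ - u _); first congr (_ + _).
    by apply/rowP => i; rewrite mxE ltn_ord.
  by rewrite [row_trunc 0 h](_ : _ = 0) ?addr0//; apply/rowP => i; rewrite !mxE.
have -> : u (x + h) - u x - dlin u x h =
    \sum_(j < n) (u (x + row_trunc j.+1 h) - u (x + row_trunc j h)
                  - h ord0 j * pd j u x).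
  by rewrite tail /dlin [in RHS]sumrB.
apply: le_trans (ler_norm_sum _ _ _) _.
rewrite mulr_natl -[X in _ *+ X]card_ord -sumr_const; apply: ler_sum => j _.
have inball (t : R) : 0 <= t <= 1 ->
    `|x - (x + row_trunc j h + (t * h ord0 j) *: e j)| < d.
  move=> t01; rewrite -addrA opprD addNKr normrN.
  exact: le_lt_trans (row_trunc_between h j t01) hd.
have [t t01|t t01 Ht] := @mean_value_line R n u (x + row_trunc j h) (e j) (h ord0 j).
  exact/du/dU/inball.
rewrite row_truncS addrA Ht -mulrBr normrM mulrC.
by apply: ler_pM => //; [apply: cu; exact: inball|exact: row_coord_le].
Qed.

Lemma continuous_pd_diff U u x : open U -> U x ->
  (forall y i, U y -> derivable u y (e i)) ->
  (forall i, {for x, continuous (pd i u)}) ->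
  differentiable u x /\ 'd u x = dlin u x :> ('rV[R]_n -> R).
Proof.
move=> oU Ux du cu.
have oUx : nbhs x U by exact: open_nbhs_nbhs.
pose dL := GRing.isLinear.Build _ _ _ _ _ (dlin_linear u x).
pose L : {linear 'rV[R]_n -> R} := HB.pack (dlin u x) dL.
have expansion : u \o shift x = cst (u x) + L +o_ (0 : 'rV[R]_n) id.
  apply/eqaddoP => eps eps0.
  (* With n + 1 in the denominator the case n = 0 is covered, and the n steps of [increment_bound]
     add up to at most eps |h|. *)
  have eps'0 : 0 < eps / n.+1%:R by rewrite divr_gt0.
  have near_i i : \forall y \near x, `|pd i u x - pd i u y| < eps / n.+1%:R.
    by move/cvgrPdist_lt : (cu i) => /(_ _ eps'0).
  have [d d0 Hd] : exists2 d : R, 0 < d & forall y, `|x - y| < d ->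
      U y /\ forall i, `|pd i u x - pd i u y| < eps / n.+1%:R.
    have all_i : \forall y \near x, forall i, `|pd i u x - pd i u y| < eps / n.+1%:R.
      exact: (@filter_forall _ _ (fun i y =>
        `|pd i u x - pd i u y| < eps / n.+1%:R) (nbhs x)).
    have : nbhs x (U `&` [set y | forall i, `|pd i u x - pd i u y| < eps / n.+1%:R]).
      exact: filterI oUx all_i.
    move=> /nbhs_ballP[d /= d0 Hd].
    by exists d => // y xy; apply: Hd; rewrite -ball_normE.
  have near0 : \forall h \near (0 : 'rV[R]_n), `|h| < d.
    apply/nbhs_ballP; exists d => //= h; rewrite -ball_normE/=.
    by rewrite sub0r normrN.
  apply: filterS near0 => h hd.
  have dU y (xy : `|x - y| < d) : U y by have [] := Hd y xy.
  have cd y i (xy : `|x - y| < d) : `|pd i u y - pd i u x| <= eps / n.+1%:R.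
    by have [_ /(_ i)] := Hd y xy; rewrite distrC => /ltW.
  have bound := increment_bound d0 dU du cd hd.
  have -> : (u \o shift x - (cst (u x) + L)) h = u (x + h) - u x - dlin u x h.
    rewrite -[LHS]/(u (h + x) - (u x + dlin u x h)).
    by rewrite (addrC h) opprD addrA.
  apply: le_trans bound _; rewrite mulrA ler_wpM2r//.
  rewrite mulrCA ler_piMr ?(ltW eps0)// ler_pdivrMr ?ltr0n// mul1r ler_nat.
  exact: leqnSn.
have dE : 'd u x = L :> ('rV[R]_n -> R).
  by apply: diff_unique => //; exact: dlin_continuous.
split; last by rewrite dE.
by apply/diff_locallyP; rewrite dE; split=> //; exact: dlin_continuous.
Qed.

(** Along the curve t -> tau (t v + x) everything depends on one real variable: derivatives of the
    components along v make the curve differentiable at 0, and composing differentials gives the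
    formula. *)
Lemma is_derive_comp_row m (w : 'rV[R]_m -> R)
    (tau : 'rV[R]_n -> 'rV[R]_m) x (v : 'rV[R]_n) :
  differentiable w (tau x) ->
  (forall r, derivable (fun y => tau y ord0 r) x v) ->
  is_derive x v (fun y => w (tau y))
    ('d w (tau x) (\row_r 'D_v (fun y => tau y ord0 r) x)).
Proof.
move=> dw dtau.
pose gam (t : R) := tau (t *: v + x).
have gam0 : gam 0 = tau x by rewrite /gam scale0r add0r.
have Dgam : derivable gam 0 1.
  apply/derivable_mxP => i r; rewrite ord1.
  exact: (derivable1P (fun y => tau y ord0 r) x v).1.
have /derivable1_diffP Fgam := Dgam.
have Fw : differentiable w (gam 0) by rewrite gam0.
have Fwg := differentiable_comp Fgam Fw.
split.
  apply: (derivable1P (fun y => w (tau y)) x v).2.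
  exact: (derivable1_diffP (w \o gam) 0).2.
rewrite -(derive_line (fun y => w (tau y))) -[LHS]/('D_1 (w \o gam) 0).
rewrite deriveE// diff_comp//= gam0; congr ('d w _ _).
rewrite -deriveE// derive_mx//; apply/rowP => r; rewrite !mxE.
exact: derive_line (fun y => tau y ord0 r) x v.
Qed.
End ChainRule.

Lemma is_derive_comp_smooth (R : realType) n m (U : set 'rV[R]_m)
    (w : 'rV[R]_m -> R) (tau : 'rV[R]_n -> 'rV[R]_m) (x : 'rV[R]_n) (i : 'I_n) :
  open U -> smooth_on U w -> U (tau x) ->
  (forall r, derivable (fun y => tau y ord0 r) x (delta_mx ord0 i)) ->
  is_derive x (delta_mx ord0 i : 'rV[R]_n) (fun y => w (tau y))
    (\sum_r pd i (fun y => tau y ord0 r) x * pd r w (tau x)).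
Proof.
move=> oU sw Ux dtau.
have [|j|dw Ew] := continuous_pd_diff oU Ux (u := w).
- by move=> y j; exact: smooth_on_derivable sw.
- exact: smooth_on_continuous (smooth_on_pd j sw) Ux.
have := is_derive_comp_row dw dtau.
by rewrite Ew /dlin; under eq_bigr do rewrite mxE.
Qed.

Lemma is_derive_coord (R : realType) n (r : 'I_n) (x v : 'rV[R]_n) :
  is_derive x v (fun y => y ord0 r) (v ord0 r).
Proof.
have Ei := @derive_id R _ x v; have Di := @derivable_id R _ x v.
have D := (derivable_mxP _ x v).1 Di ord0 r; split=> //.
by move: Ei; rewrite derive_mx// => /rowP /(_ r); rewrite mxE.
Qed.

Lemma smooth_on_coord (R : realType) n (U : set 'rV[R]_n) (r : 'I_n) :
  smooth_on U (fun y => y ord0 r).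
Proof.
apply/smooth_onP => -[|k] /=.
  by split=> // x _; exact: coord_continuous.
split; first by move=> x _; exact: coord_continuous.
split=> [x i _|i]; first by case: (is_derive_coord r x (delta_mx ord0 i)).
have -> : pd i (fun y : 'rV[R]_n => y ord0 r) = fun=> (r == i)%:R.
  by apply/funext => x; case: (is_derive_coord r x (delta_mx ord0 i)) => _; rewrite mxE eqxx.
exact: (smooth_onP U _).1 (@smooth_on_cst R n U _) k.
Qed.

(** * Commuting covariant derivatives of a vector field *)

Section AffineIdentity.
Variables (R : comRingType) (n : nat).

(** Everything is taken at one point: [A k i] stands for D_k v^i, [dv] and [ddv] for the first and
    second partials of v, [dA] for the partials of A, and [dGam l i k j] for d_l Gamma^i_kj. The
    left side is div (D_v v) after the product rule, the last sum on the right is Ric (v, v).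
    Symmetry of [ddv] is the equality of mixed partials, symmetry of [Gam] is vanishing torsion. *)
Lemma nabla_commute (v : 'I_n -> R) (A dv : 'I_n -> 'I_n -> R)
    (Gam : 'I_n -> 'I_n -> 'I_n -> R) (dGam : 'I_n -> 'I_n -> 'I_n -> 'I_n -> R)
    (ddv : 'I_n -> 'I_n -> 'I_n -> R) (dA : 'I_n -> 'I_n -> 'I_n -> R) :
  (forall k i, A k i = dv k i + \sum_j Gam i k j * v j) ->
  (forall l k i, dA l k i = ddv l k i
     + \sum_j (dGam l i k j * v j + Gam i k j * dv l j)) ->
  (forall l k i, ddv l k i = ddv k l i) ->
  (forall i j k, Gam k i j = Gam k j i) ->
  \sum_i (\sum_k (dv i k * A k i + v k * dA i k i)
          + \sum_j Gam i i j * (\sum_k v k * A k j))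
  = \sum_i \sum_k A i k * A k i + \sum_k v k * (\sum_i dA k i i)
    + \sum_k \sum_j v k * v j * (\sum_i (dGam i i k j - dGam k i i j
       + \sum_m (Gam i i m * Gam m k j - Gam i k m * Gam m i j))).
Proof.
move=> AE dAE ddvC GamC.
have dvE k i : dv k i = A k i - \sum_j Gam i k j * v j.
  by rewrite AE addrK.
(* The contracted Ricci identity, written with plain partials of A; the last double sum collects the
   connection terms that would make them covariant. *)
have key k : \sum_i dA i k i = \sum_i dA k i i
  + \sum_j v j * (\sum_i (dGam i i k j - dGam k i i j
       + \sum_m (Gam i i m * Gam m k j - Gam i k m * Gam m i j)))
  + \sum_i \sum_j (Gam i k j * A i j - Gam i i j * A k j).
  transitivity (\sum_i dA k i i + \sum_i \sum_j
    ((dGam i i k j - dGam k i i j) * v j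
     + (Gam i k j * dv i j - Gam i i j * dv k j))).
    rewrite -big_split; apply: eq_bigr => i _ /=.
    rewrite !dAE (ddvC i k) -addrA; congr (_ + _).
    by rewrite -big_split; apply: eq_bigr => j _ /=; ring.
  rewrite -addrA; congr (_ + _).
  rewrite [X in _ = X + _](_ : _ = \sum_i \sum_j
     (dGam i i k j - dGam k i i j
       + \sum_m (Gam i i m * Gam m k j - Gam i k m * Gam m i j)) * v j); last first.
    rewrite exchange_big; apply: eq_bigr => j _ /=.
    by rewrite mulrC mulr_suml.
  rewrite -big_split; apply: eq_bigr => i _ /=.
  under eq_bigr => j _ do rewrite !dvE mulrBr mulrBr.
  under [X in _ = X + _]eq_bigr => j _ do rewrite mulrDl.
  rewrite !big_split /= -!addrA; congr (_ + _).
  rewrite !sumrN !sumrB.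
  have -> : \sum_j (\sum_m (Gam i i m * Gam m k j - Gam i k m * Gam m i j)) * v j
    = \sum_j Gam i i j * (\sum_m Gam j k m * v m)
      - \sum_j Gam i k j * (\sum_m Gam j i m * v m).
    transitivity (\sum_j \sum_m ((Gam i i m * Gam m k j) * v j
        - (Gam i k m * Gam m i j) * v j)).
      by apply: eq_bigr => j _; rewrite mulr_suml; apply: eq_bigr => m _; rewrite mulrBl.
    rewrite exchange_big -sumrB; apply: eq_bigr => m _ /=.
    rewrite sumrB !mulr_sumr; congr (_ - _);
      by apply: eq_bigr => j _; rewrite mulrA.
  by ring.
rewrite big_split /=.
have -> : \sum_i \sum_k (dv i k * A k i + v k * dA i k i)
   = \sum_i \sum_k A i k * A k i - \sum_i \sum_k (\sum_j Gam k i j * v j) * A k i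
     + \sum_k v k * \sum_i dA i k i.
  rewrite -sumrB [X in _ + X](_ : _ = \sum_i \sum_k v k * dA i k i); last first.
    by rewrite exchange_big; apply: eq_bigr => k _; rewrite mulr_sumr.
  rewrite -big_split; apply: eq_bigr => i _ /=.
  rewrite big_split /=; congr (_ + _); rewrite -sumrB.
  by apply: eq_bigr => k _; rewrite dvE mulrBl.
under [X in _ - _ + X + _]eq_bigr => k _ do rewrite key !mulrDr.
rewrite !big_split /=.
(* Besides the three wanted terms there remain two sums of type Gamma A, each with both signs. They
   are brought to a common form here; the second one uses the symmetry of Gamma. *)
have -> : \sum_i \sum_j Gam i i j * (\sum_k v k * A k j) =
    \sum_k v k * \sum_i \sum_j Gam i i j * A k j.
  rewrite (eq_bigr (fun i => \sum_k \sum_j v k * (Gam i i j * A k j))); last first.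
    move=> i _; rewrite exchange_big; apply: eq_bigr => j _ /=.
    by rewrite mulr_sumr; apply: eq_bigr => k _; ring.
  rewrite exchange_big; apply: eq_bigr => k _; rewrite mulr_sumr.
  by apply: eq_bigr => i _; rewrite mulr_sumr.
have -> : \sum_i \sum_k (\sum_j Gam k i j * v j) * A k i =
    \sum_k v k * \sum_i \sum_j Gam i k j * A i j.
  transitivity (\sum_i \sum_k \sum_j v j * (Gam k j i * A k i)).
    apply: eq_bigr => i _; apply: eq_bigr => k _; rewrite mulr_suml.
    by apply: eq_bigr => j _; rewrite GamC; ring.
  rewrite exchange_big /=.
  transitivity (\sum_i \sum_k \sum_j v k * (Gam i k j * A i j)).
    by apply: eq_bigr => i _; rewrite exchange_big.
  rewrite exchange_big /=; apply: eq_bigr => k _.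
  by rewrite mulr_sumr; apply: eq_bigr => i _; rewrite mulr_sumr.
have -> : \sum_k v k * (\sum_i \sum_j (Gam i k j * A i j - Gam i i j * A k j))
   = \sum_k v k * (\sum_i \sum_j Gam i k j * A i j)
     - \sum_k v k * (\sum_i \sum_j Gam i i j * A k j).
  rewrite -sumrB; apply: eq_bigr => k _; rewrite -mulrBr -sumrB; congr (_ * _).
  by apply: eq_bigr => i _; rewrite sumrB.
have -> : \sum_k \sum_j v k * v j * (\sum_i (dGam i i k j - dGam k i i j
       + \sum_m (Gam i i m * Gam m k j - Gam i k m * Gam m i j)))
  = \sum_k v k * (\sum_j v j * (\sum_i (dGam i i k j - dGam k i i j
       + \sum_m (Gam i i m * Gam m k j - Gam i k m * Gam m i j)))).
  by apply: eq_bigr => k _; rewrite mulr_sumr; apply: eq_bigr => j _; rewrite mulrA.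
by ring.
Qed.
End AffineIdentity.

(** * Riemannian geometry on an open coordinate set: gradient, Hessian, Bochner's formula *)

Lemma trmx_entry (T : Type) (A : 'M[T]_1) : A ord0 ord0 = A^T ord0 ord0.
Proof. by rewrite mxE. Qed.

Section LocalMetric.
Variables (R : realType) (n : nat) (U : set 'rV[R]_n) (g : 'rV[R]_n -> 'M[R]_n).
Hypotheses (oU : open U) (sg : forall i j, smooth_on U (fun y => g y i j))
  (symg : forall x, U x -> (g x)^T = g x)
  (unitg : forall x, U x -> g x \in unitmx).
Implicit Types (u a b : 'rV[R]_n -> R) (x y : 'rV[R]_n).

Definition dcov u x : 'rV[R]_n := \row_i pd i u x.

(* the metric on covectors, [<grad a, grad b>] *)
Definition gradprod a b x : R := (dcov a x *m invmx (g x) *m (dcov b x)^T) ord0 ord0.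

Definition hess_mx u x : 'M[R]_n := \matrix_(i, j) hessian g u i j x.

(** D_k of the gradient, component i: the Hessian with one index raised, see [covdE]. *)
Definition covd u k i x : R :=
  pd k (fun y => grad g u y ord0 i) x
  + \sum_j christoffel g i k j x * grad g u x ord0 j.

Lemma metric_sym i j x : U x -> g x i j = g x j i.
Proof. by move=> Ux; rewrite -{1}(symg Ux) mxE. Qed.

Lemma invmx_sym x : U x -> (invmx (g x))^T = invmx (g x).
Proof. by move=> Ux; rewrite trmx_inv symg. Qed.

Lemma ginv_sym i j x : U x -> ginv g i j x = ginv g j i x.
Proof. by move=> Ux; rewrite /ginv -{1}invmx_sym// mxE. Qed.

Lemma gradE u x : U x -> grad g u x = dcov u x *m invmx (g x).
Proof.
move=> Ux; apply/rowP => i; rewrite !mxE; apply: eq_bigr => j _.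
by rewrite ginv_sym// mulrC mxE.
Qed.

Lemma grad_lower u x j : U x -> \sum_i grad g u x ord0 i * g x i j = pd j u x.
Proof.
move=> Ux; have := congr1 (fun A : 'rV[R]_n => (A *m g x) ord0 j) (gradE u Ux).
by rewrite mulmxKV ?unitg// !mxE.
Qed.

Lemma inner_grad a b x : U x -> inner g x (grad g a x) (grad g b x) = gradprod a b x.
Proof.
move=> Ux; rewrite /inner /gradprod !gradE// mulmxKV ?unitg//.
by rewrite trmx_mul invmx_sym// mulmxA.
Qed.

Lemma gradprod_sum a b x : U x ->
  gradprod a b x = \sum_j pd j a x * grad g b x ord0 j.
Proof.
move=> Ux; rewrite /gradprod -mulmxA mxE; apply: eq_bigr => j _.
by rewrite mxE; congr (_ * _); rewrite !mxE; apply: eq_bigr => i _; rewrite ?mxE.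
Qed.

Lemma gradprodC a b x : U x -> gradprod a b x = gradprod b a x.
Proof.
move=> Ux; rewrite /gradprod trmx_entry.
by rewrite !trmx_mul trmxK invmx_sym// mulmxA.
Qed.

Lemma smooth_on_ginv i j : smooth_on U (ginv g i j).
Proof. exact: smooth_on_invmx. Qed.

Lemma smooth_on_grad u i : smooth_on U u ->
  smooth_on U (fun y => grad g u y ord0 i).
Proof.
move=> su.
have E x : U x -> \sum_j ginv g i j x * pd j u x = grad g u x ord0 i.
  by move=> _; rewrite mxE.
apply: (smooth_on_eq oU E (smooth_on_sum xpredT oU _)) => j.
exact: (smooth_onM oU (smooth_on_ginv i j) (smooth_on_pd j su)).
Qed.

Lemma smooth_on_christoffel k i j : smooth_on U (christoffel g k i j).
Proof.
have S l := smooth_onB oU (smooth_onD oU (smooth_on_pd i (sg j l))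
  (smooth_on_pd j (sg i l))) (smooth_on_pd l (sg i j)).
exact: (smooth_onM oU (@smooth_on_cst R n U 2^-1) (smooth_on_sum xpredT oU
  (fun l => smooth_onM oU (smooth_on_ginv k l) (S l)))).
Qed.

Lemma smooth_on_gradprod a b : smooth_on U a -> smooth_on U b ->
  smooth_on U (gradprod a b).
Proof.
move=> sa sb.
have E x : U x -> \sum_j pd j a x * grad g b x ord0 j = gradprod a b x.
  by move=> Ux; rewrite gradprod_sum.
apply: (smooth_on_eq oU E (smooth_on_sum xpredT oU _)) => j.
exact: (smooth_onM oU (smooth_on_pd j sa) (smooth_on_grad j sb)).
Qed.

Lemma pd_metric_sym k i j x : U x ->
  pd k (fun y => g y i j) x = pd k (fun y => g y j i) x.
Proof.
by move=> Ux; apply: (pd_open_eq _ oU Ux) => y; exact: metric_sym.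
Qed.

Lemma christoffel_sym k i j x : U x -> christoffel g k i j x = christoffel g k j i x.
Proof.
move=> Ux; congr (_ * _); apply: eq_bigr => l _; congr (_ * _).
by rewrite (pd_metric_sym l i j Ux); congr (_ - _); rewrite addrC.
Qed.

Lemma hess_sym u x : smooth_on U u -> U x -> (hess_mx u x)^T = hess_mx u x.
Proof.
move=> su Ux; apply/matrixP => i j; rewrite !mxE /hessian.
rewrite (smooth_on_schwarz _ _ oU su Ux); congr (_ - _); apply: eq_bigr => k _.
by rewrite christoffel_sym.
Qed.

(** Lowering the index cancels the inverse metric and leaves the symbols of the first kind, which
    are linear in the derivatives of g. *)
Lemma christoffel_lower k i j x : U x ->
  \sum_m christoffel g m i j x * g x m k =
  2^-1 * (pd i (fun y => g y j k) x + pd j (fun y => g y i k) x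
     - pd k (fun y => g y i j) x).
Proof.
move=> Ux; pose X : 'cV[R]_n := \col_l (pd i (fun y => g y j l) x
  + pd j (fun y => g y i l) x - pd l (fun y => g y i j) x).
have cE m : christoffel g m i j x = 2^-1 * (invmx (g x) *m X) m ord0.
  by rewrite mxE; congr (_ * _); apply: eq_bigr => l _; rewrite [X l _]mxE.
have -> : \sum_m christoffel g m i j x * g x m k
    = 2^-1 * (g x *m (invmx (g x) *m X)) k ord0.
  rewrite [in RHS]mxE mulr_sumr; apply: eq_bigr => m _.
  by rewrite cE (metric_sym m k Ux); ring.
by rewrite mulmxA mulmxV ?unitg// mul1mx mxE.
Qed.

(** Metric compatibility. Differentiating d_j u = g_ij (grad u)^i produces derivatives of g, and the
    two Christoffel sums, reduced to the first kind, account for exactly these. *)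
Lemma covd_lower u k j x : smooth_on U u -> U x ->
  \sum_i covd u k i x * g x i j = hessian g u k j x.
Proof.
move=> su Ux.
have dgr i : derivable (fun y => grad g u y ord0 i) x (delta_mx ord0 k : 'rV[R]_n).
  exact: smooth_on_derivable (smooth_on_grad i su) Ux.
have dg i l : derivable (fun y => g y i l) x (delta_mx ord0 k : 'rV[R]_n).
  exact: smooth_on_derivable (sg i l) Ux.
have ddu : pd k (pd j u) x =
    \sum_i (pd k (fun y => grad g u y ord0 i) x * g x i j
            + grad g u x ord0 i * pd k (fun y => g y i j) x).
  rewrite (@pd_open_eq _ _ U _ (fun y => \sum_i grad g u y ord0 i * g y i j)) //;
    last by move=> y Uy; rewrite grad_lower.
  rewrite pd_sum => [|i]; last exact: derivableM_fun.
  by apply: eq_bigr => i _; rewrite pdM.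
have cu : \sum_m christoffel g m k j x * pd m u x = \sum_l grad g u x ord0 l *
    (2^-1 * (pd k (fun y => g y j l) x + pd j (fun y => g y k l) x
     - pd l (fun y => g y k j) x)).
  under eq_bigr => m _ do rewrite -grad_lower// mulr_sumr.
  rewrite exchange_big; apply: eq_bigr => l _ /=.
  rewrite -christoffel_lower// mulr_sumr; apply: eq_bigr => m _.
  by rewrite (metric_sym l m Ux); ring.
have cg : \sum_i (\sum_l christoffel g i k l x * grad g u x ord0 l) * g x i j =
   \sum_l grad g u x ord0 l *
    (2^-1 * (pd k (fun y => g y l j) x + pd l (fun y => g y k j) x
     - pd j (fun y => g y k l) x)).
  under eq_bigr => m _ do rewrite mulr_suml.
  rewrite exchange_big; apply: eq_bigr => l _ /=.
  rewrite -christoffel_lower// mulr_sumr; apply: eq_bigr => m _.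
  by ring.
rewrite /hessian ddu cu; under eq_bigr do rewrite mulrDl.
rewrite big_split /= cg -sumrB -big_split; apply: eq_bigr => l _ /=.
by rewrite (pd_metric_sym k l j Ux); field.
Qed.

Lemma covdE u k i x : smooth_on U u -> U x ->
  covd u k i x = (hess_mx u x *m invmx (g x)) k i.
Proof.
move=> su Ux; have -> : hess_mx u x = (\matrix_(k, i) covd u k i x) *m g x.
  apply/matrixP => a b; rewrite !mxE -covd_lower//.
  by apply: eq_bigr => l _; rewrite mxE.
by rewrite mulmxK ?unitg// mxE.
Qed.

(** The Christoffel terms in d_k d_j a and in d_k (grad b)^j enter with opposite signs and cancel,
    so the product rule holds with covariant derivatives. *)
Lemma pd_gradprod a b k x : smooth_on U a -> smooth_on U b -> U x ->
  pd k (gradprod a b) x =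
  \sum_j (hess_mx a x k j * grad g b x ord0 j + hess_mx b x k j * grad g a x ord0 j).
Proof.
move=> sa sb Ux.
have da j : derivable (pd j a) x (delta_mx ord0 k : 'rV[R]_n).
  exact: smooth_on_derivable (smooth_on_pd j sa) Ux.
have db j : derivable (fun y => grad g b y ord0 j) x (delta_mx ord0 k : 'rV[R]_n).
  exact: smooth_on_derivable (smooth_on_grad j sb) Ux.
rewrite (@pd_open_eq _ _ U _ (fun y => \sum_j pd j a y * grad g b y ord0 j)) //;
  last by move=> y Uy; rewrite gradprod_sum.
rewrite pd_sum => [|j]; last exact: derivableM_fun.
under eq_bigr => j _ do rewrite pdM//.
have E1 j : pd k (pd j a) x = hess_mx a x k j + \sum_m christoffel g m k j x * pd m a x.
  by rewrite mxE subrK.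
have E2 j : pd k (fun y => grad g b y ord0 j) x =
    covd b k j x - \sum_m christoffel g j k m x * grad g b x ord0 m.
  by rewrite addrK.
under eq_bigr => j _ do rewrite E1 E2 mulrDl mulrBr.
rewrite !big_split /= -!addrA; congr (_ + _).
rewrite sumrN (_ : \sum_j pd j a x * covd b k j x =
    \sum_j hess_mx b x k j * grad g a x ord0 j); last first.
  under eq_bigr => j _ do rewrite -grad_lower// mulr_suml.
  rewrite exchange_big; apply: eq_bigr => l _ /=.
  rewrite [hess_mx _ _ _ _]mxE -covd_lower// mulr_suml; apply: eq_bigr => m _.
  by rewrite (metric_sym l m Ux); ring.
rewrite [X in X + _](_ : _ = \sum_j pd j a x *
   \sum_m christoffel g j k m x * grad g b x ord0 m); first by ring.
transitivity (\sum_j \sum_m christoffel g m k j x * pd m a x * grad g b x ord0 j).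
  by apply: eq_bigr => j _; rewrite mulr_suml.
rewrite exchange_big; apply: eq_bigr => j _; rewrite mulr_sumr.
by apply: eq_bigr => m _; ring.
Qed.

Lemma dcov_gradprod a b x : smooth_on U a -> smooth_on U b -> U x ->
  dcov (gradprod a b) x =
  grad g b x *m hess_mx a x + grad g a x *m hess_mx b x.
Proof.
move=> sa sb Ux; apply/rowP => k; rewrite mxE pd_gradprod// big_split !mxE.
congr (_ + _); apply: eq_bigr => j _.
  by rewrite -{1}(hess_sym sa Ux) [in LHS]mxE mulrC.
by rewrite -{1}(hess_sym sb Ux) [in LHS]mxE mulrC.
Qed.

(** Each product on the right expands by [dcov_gradprod] into two Hessian values; by symmetry four
    of the six cancel and the other two agree. Since the right side uses [gradprod] only, invariance
    under change of chart passes from [gradprod] to the Hessian. *)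
Lemma hess_gradprod a b u x : smooth_on U a -> smooth_on U b -> smooth_on U u ->
  U x ->
  (grad g a x *m hess_mx u x *m (grad g b x)^T) ord0 ord0 =
  2^-1 * (gradprod a (gradprod b u) x + gradprod b (gradprod a u) x
          - gradprod u (gradprod a b) x).
Proof.
move=> sa sb su Ux.
have E c d e : smooth_on U c -> smooth_on U d -> gradprod e (gradprod c d) x =
    (grad g d x *m hess_mx c x *m (grad g e x)^T) ord0 ord0
    + (grad g c x *m hess_mx d x *m (grad g e x)^T) ord0 ord0.
  move=> sc sd; rewrite gradprodC// /gradprod dcov_gradprod// -mulmxA.
  rewrite [in LHS](_ : invmx (g x) *m _ = (grad g e x)^T); last first.
    by rewrite gradE// trmx_mul invmx_sym.
  by rewrite mulmxDl mxE.
have S c d e : smooth_on U c ->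
    (grad g d x *m hess_mx c x *m (grad g e x)^T) ord0 ord0 =
    (grad g e x *m hess_mx c x *m (grad g d x)^T) ord0 ord0.
  by move=> sc; rewrite trmx_entry !trmx_mul trmxK hess_sym// mulmxA.
have half (p p1 q q1 r r1 Xa Xb Xu : R) : Xa = q + p1 -> Xb = r + p ->
    Xu = r1 + q1 -> q = q1 -> r = r1 -> p1 = p -> p = 2^-1 * (Xa + Xb - Xu).
  by move=> -> -> -> -> -> ->; field.
exact: half (E b u a sb su) (E a u b sa su) (E a b u sa sb)
  (S b u a sb) (S a u b sa) (S u b a su).
Qed.

Lemma smooth_on_covd u k i : smooth_on U u -> smooth_on U (covd u k i).
Proof.
move=> su; have sv j := smooth_on_grad j su.
exact: (smooth_onD oU (smooth_on_pd k (sv i)) (smooth_on_sum xpredT oU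
  (fun j => smooth_onM oU (smooth_on_christoffel i k j) (sv j)))).
Qed.

Lemma trace_covd u x : smooth_on U u -> U x ->
  \tr (hess_mx u x *m invmx (g x) *m (hess_mx u x *m invmx (g x))) =
  \sum_i \sum_k covd u i k x * covd u k i x.
Proof.
move=> su Ux; apply: eq_bigr => i _; rewrite mxE; apply: eq_bigr => k _.
by rewrite !(covdE _ _ su Ux).
Qed.

Lemma divergence_nabla u x : smooth_on U u -> U x ->
  divergence g (fun y => grad g (gradprod u u) y) x =
  2 * \tr (hess_mx u x *m invmx (g x) *m (hess_mx u x *m invmx (g x)))
  + 2 * \sum_k grad g u x ord0 k * pd k (laplacian g u) x
  + 2 * ricci g x (grad g u x) (grad g u x).
Proof.
move=> su Ux.
pose v i y := grad g u y ord0 i.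
have sv i : smooth_on U (v i) by exact: smooth_on_grad.
have scov k i : smooth_on U (covd u k i) by exact: smooth_on_covd.
(* With v = grad u, the gradient of |v|^2 is 2 D_v v; this is the source of every factor 2 in the
   formula. *)
have gE i y : U y -> grad g (gradprod u u) y ord0 i = 2 * \sum_k v k y * covd u k i y.
  move=> Uy; rewrite gradE// dcov_gradprod// mulmxDl -mulmxA [LHS]mxE -mulr2n.
  rewrite -[LHS]mulr_natl mxE; congr (2 * _); apply: eq_bigr => k _.
  by rewrite (covdE _ _ su Uy).
have dv i k : derivable (v i) x (delta_mx ord0 k : 'rV[R]_n).
  exact: smooth_on_derivable (sv i) Ux.
have dpv i k l : derivable (pd l (v i)) x (delta_mx ord0 k : 'rV[R]_n).
  exact: smooth_on_derivable (smooth_on_pd l (sv i)) Ux.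
have dc i k l : derivable (covd u k i) x (delta_mx ord0 l : 'rV[R]_n).
  exact: smooth_on_derivable (scov k i) Ux.
have dG i j k l : derivable (christoffel g k i j) x (delta_mx ord0 l : 'rV[R]_n).
  exact: smooth_on_derivable (smooth_on_christoffel k i j) Ux.
have lapE y : U y -> laplacian g u y = \sum_i covd u i i y.
  move=> Uy; apply: eq_bigr => i _; rewrite covdE// mxE.
  by apply: eq_bigr => j _; rewrite mxE ginv_sym// mulrC.
have -> : \sum_k grad g u x ord0 k * pd k (laplacian g u) x =
    \sum_k v k x * \sum_i pd k (covd u i i) x.
  apply: eq_bigr => k _; congr (_ * _).
  by rewrite (pd_open_eq _ oU Ux lapE) pd_sum.
rewrite (trace_covd su Ux).
have := @nabla_commute R n (fun i => v i x) (fun k i => covd u k i x)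
  (fun k i => pd k (v i) x) (fun i j k => christoffel g i j k x)
  (fun l i k j => pd l (christoffel g i k j) x)
  (fun l k i => pd l (pd k (v i)) x) (fun l k i => pd l (covd u k i) x).
move=> /(_ _ _ _ _)H.
(* [ricci] at (grad u, grad u) unfolds by definition to the curvature sum of [nabla_commute]. *)
rewrite -!mulrDr -[X in _ = 2 * (_ + X)]/(\sum_k \sum_j
  v k x * v j x * \sum_i (pd i (christoffel g i k j) x - pd k (christoffel g i i j) x
    + \sum_m (christoffel g i i m x * christoffel g m k j x
      - christoffel g i k m x * christoffel g m i j x))).
rewrite -H {H}.
- rewrite /divergence mulr_sumr; apply: eq_bigr => i _; rewrite mulrDr; congr (_ + _).
    rewrite (pd_open_eq _ oU Ux (gE i)) pdZ; last first.
      by apply: derivable_sum_fun => k; exact: derivableM_fun.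
    congr (_ * _); rewrite pd_sum => [|k]; last exact: derivableM_fun.
    by apply: eq_bigr => k _; rewrite pdM.
  by rewrite mulr_sumr; apply: eq_bigr => j _; rewrite gE// mulrCA.
- by [].
- move=> l k i; rewrite /covd pdD; first last.
  + by apply: derivable_sum_fun => j; exact: derivableM_fun (dG _ _ _ _) (dv _ _).
  + exact: dpv.
  rewrite pd_sum => [|j]; last exact: derivableM_fun (dG _ _ _ _) (dv _ _).
  congr (_ + _); apply: eq_bigr => j _.
  by rewrite (pdM (dG _ _ _ _) (dv _ _)).
- by move=> l k i; exact: (smooth_on_schwarz _ _ oU (sv i) Ux).
- by move=> i j k; exact: christoffel_sym.
Qed.

End LocalMetric.

(** * Factorization of positive definite matrices, the source of orthonormal frames *)

Section Cholesky.
Variable R : rcfType.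

(** Induction through the Schur complement [D'] of the upper left entry; each stage takes the square
    root of that positive entry. *)
Lemma cholesky n (S : 'M[R]_n) : S^T = S ->
  (forall v : 'rV[R]_n, v != 0 -> 0 < (v *m S *m v^T) ord0 ord0) ->
  exists B : 'M[R]_n, S = B *m B^T.
Proof.
elim: n S => [|n IH] S symS posS.
  by exists 0; apply/matrixP => -[].
move: S symS posS; change n.+1 with (1 + n)%N => S symS posS.
pose a := ulsubmx S; pose b := ursubmx S; pose D := drsubmx S.
have SE : S = block_mx a b b^T D.
  rewrite -{1}[S]submxK; congr block_mx.
  by rewrite /b trmx_ursub symS.
have aS : a = (a ord0 ord0)%:M by rewrite [LHS]mx11_scalar.
have symD : D^T = D by rewrite /D trmx_drsub symS.
have quad (s : 'rV[R]_1) (v : 'rV[R]_n) : row_mx s v *m S *m (row_mx s v)^T =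
    s *m a *m s^T + v *m b^T *m s^T + (s *m b *m v^T + v *m D *m v^T).
  by rewrite SE mul_row_block tr_row_mx mul_row_col !mulmxDl.
set a0 := a ord0 ord0 in aS.
have a0_gt0 : 0 < a0.
  have := posS (row_mx 1%:M 0) _; rewrite quad trmx0 !mul0mx !mulmx0 !addr0.
  rewrite trmx1 mul1mx mulmx1; apply.
  rewrite -row_mx0; apply/eqP => /eq_row_mx[/matrixP /(_ ord0 ord0)].
  by rewrite !mxE eqxx => /eqP; rewrite oner_eq0.
pose D' := D - a0^-1 *: (b^T *m b).
have [||B' DE] := IH D'.
- by rewrite /D' linearB linearZ /= symD trmx_mul trmxK.
- move=> v v0.
  (* For fixed v this first entry minimizes the form of S, and the minimum is the form of [D'] at
     v. *)
  have := posS (row_mx (- a0^-1 *: (v *m b^T)) v) _.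
  have -> : row_mx (- a0^-1 *: (v *m b^T)) v *m S *m
      (row_mx (- a0^-1 *: (v *m b^T)) v)^T = v *m D' *m v^T.
    rewrite quad aS /D' mulmxBr mulmxBl linearZ /= trmx_mul trmxK.
    rewrite mul_mx_scalar -!scalemxAl -!scalemxAr -!scalemxAl !scalerA !mulmxA.
    rewrite -mulrA mulrNN mulrA mulfV ?gt_eqF// mul1r.
    by rewrite !scaleNr subrr add0r addrC.
  apply; apply: contra v0; rewrite -row_mx0 => /eqP/eq_row_mx[_ ->].
  exact: eqxx.
exists (block_mx (Num.sqrt a0)%:M 0 ((Num.sqrt a0)^-1 *: b^T) B').
have s0 : Num.sqrt a0 != 0 by rewrite gt_eqF// sqrtr_gt0.
rewrite tr_block_mx mulmx_block !trmx0 tr_scalar_mx linearZ /= trmxK.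
rewrite !mulmx0 !mul0mx !addr0 -scalar_mxM -expr2 sqr_sqrtr ?ltW// -aS.
rewrite mul_scalar_mx scalerA mulfV// scale1r.
rewrite mul_mx_scalar scalerA mulfV// scale1r.
rewrite -scalemxAl -scalemxAr scalerA -DE -invfM -expr2 sqr_sqrtr ?ltW//.
by rewrite SE /D' addrC subrK.
Qed.

End Cholesky.

(** * Full contractions in an orthonormal frame *)

Section Contraction.
Variables (R : comRingType) (n : nat).
Implicit Types (t : 'I_n -> 'I_n -> 'I_n -> R) (B P : 'M[R]_n).

(** When P is an inverse metric, the columns of B are an orthonormal frame, and contraction with P
    becomes the dot product of frame components. *)
Lemma contract1 P B (F F' : 'I_n -> R) : P = B *m B^T ->
  \sum_i \sum_a P i a * (F i * F' a) =
  \sum_p (\sum_i B i p * F i) * (\sum_a B a p * F' a).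
Proof.
move=> ->.
transitivity (\sum_i \sum_a \sum_p (B i p * F i) * (B a p * F' a)).
  apply: eq_bigr => i _; apply: eq_bigr => a _; rewrite mxE mulr_suml.
  by apply: eq_bigr => p _; rewrite mxE; ring.
under eq_bigr => i _ do rewrite exchange_big.
rewrite exchange_big; apply: eq_bigr => p _ /=.
by rewrite mulr_suml; apply: eq_bigr => i _; rewrite mulr_sumr.
Qed.

(** The spectator index s lives in a finite type, so that it can be one index or a pair of indices
    that are already contracted. *)
Lemma contract1_sum (I : finType) P B (F F' : 'I_n -> I -> R) : P = B *m B^T ->
  \sum_i \sum_a P i a * (\sum_s F i s * F' a s) =
  \sum_p \sum_s (\sum_i B i p * F i s) * (\sum_a B a p * F' a s).
Proof.
move=> PE; rewrite [RHS]exchange_big /=.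
under [RHS]eq_bigr => s _ do rewrite -(contract1 (F^~ s) (F'^~ s) PE).
rewrite [RHS]exchange_big; apply: eq_bigr => i _ /=.
rewrite exchange_big; apply: eq_bigr => a _ /=.
by rewrite mulr_sumr.
Qed.

Definition frame3 B t p q r : R :=
  \sum_i B i p * \sum_j B j q * \sum_k B k r * t i j k.

(** Regroup by the index pairs (i, a), (j, b), (k, c) and contract from the innermost pair
    outwards. *)
Lemma contract3 P B t : P = B *m B^T ->
  \sum_i \sum_j \sum_k \sum_a \sum_b \sum_c
    P i a * P j b * P k c * t i j k * t a b c
  = \sum_p \sum_q \sum_r frame3 B t p q r ^+ 2.
Proof.
move=> PE.
transitivity (\sum_i \sum_a P i a * \sum_j \sum_b P j b * \sum_k \sum_c
    P k c * (t i j k * t a b c)).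
  apply: eq_bigr => i _.
  transitivity (\sum_j \sum_a \sum_k \sum_b \sum_c
      P i a * P j b * P k c * t i j k * t a b c).
    by apply: eq_bigr => j _; rewrite exchange_big.
  rewrite exchange_big; apply: eq_bigr => a _ /=.
  rewrite mulr_sumr; apply: eq_bigr => j _; rewrite exchange_big mulr_sumr.
  apply: eq_bigr => b _; rewrite !mulr_sumr; apply: eq_bigr => k _.
  by rewrite !mulr_sumr; apply: eq_bigr => c _; ring.
transitivity (\sum_i \sum_a P i a * \sum_q \sum_r
   (\sum_j B j q * \sum_k B k r * t i j k) *
   (\sum_b B b q * \sum_c B c r * t a b c)).
  apply: eq_bigr => i _; apply: eq_bigr => a _; congr (_ * _).
  rewrite -(contract1_sum (fun j r => \sum_k B k r * t i j k)
    (fun b r => \sum_c B c r * t a b c) PE).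
  apply: eq_bigr => j _; apply: eq_bigr => b _; congr (_ * _).
  exact: contract1.
under eq_bigr => i _ do under eq_bigr => a _ do rewrite pair_bigA.
rewrite (contract1_sum (fun i s => \sum_j B j s.1 * \sum_k B k s.2 * t i j k)
  (fun i s => \sum_j B j s.1 * \sum_k B k s.2 * t i j k) PE).
by apply: eq_bigr => p _; rewrite pair_bigA.
Qed.

Definition sum3 (f : 'I_n -> 'I_n -> 'I_n -> R) : R := \sum_p \sum_q \sum_r f p q r.

Lemma sum3D f f' : sum3 (fun p q r => f p q r + f' p q r) = sum3 f + sum3 f'.
Proof.
rewrite /sum3 -big_split; apply: eq_bigr => p _; rewrite -big_split.
by apply: eq_bigr => q _; rewrite -big_split.
Qed.

Lemma sum3Z c f : sum3 (fun p q r => c * f p q r) = c * sum3 f.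
Proof.
rewrite /sum3 mulr_sumr; apply: eq_bigr => p _; rewrite mulr_sumr.
by apply: eq_bigr => q _; rewrite mulr_sumr.
Qed.

Lemma sum_delta (q : 'I_n) (F : 'I_n -> R) : \sum_r (q == r)%:R * F r = F q.
Proof.
rewrite (bigD1 q)//= eqxx mul1r big1 ?addr0// => r.
by rewrite eq_sym => /negbTE ->; rewrite mul0r.
Qed.

(** Squaring the four terms gives the ten sums [S1] to [S10]. In [S9] and [S10] the Kronecker symbol
    contracts H with itself, so they vanish with the trace; all others are multiples of |H|^2 |w|^2
    or |r|^2. *)
Lemma orthonormal_T_norm (H : 'M[R]_n) (w : 'rV[R]_n) (al ga : R) :
  H^T = H -> \tr H = 0 ->
  let r := w *m H in
  sum3 (fun p q s => (al * (H p s * w ord0 q - H q s * w ord0 p)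
     - ga * (r ord0 p * (q == s)%:R - r ord0 q * (p == s)%:R)) ^+ 2)
  = 2 * al ^+ 2 * (\tr (H *m H) * (w *m w^T) ord0 ord0 - (r *m r^T) ord0 ord0)
    + (2 * (n%:R - 1) * ga ^+ 2 - 4 * al * ga) * (r *m r^T) ord0 ord0.
Proof.
move=> symH trH r.
have HE p s : H p s = H s p by rewrite -{1}symH mxE.
have rE s : r ord0 s = \sum_p w ord0 p * H p s by rewrite mxE.
move: r rE => r rE.
have rrE : (r *m r^T) ord0 ord0 = \sum_p r ord0 p ^+ 2.
  by rewrite [LHS]mxE; apply: eq_bigr => p _; rewrite [r^T _ _]mxE.
have wwE : (w *m w^T) ord0 ord0 = \sum_p w ord0 p ^+ 2.
  by rewrite mxE; apply: eq_bigr => p _; rewrite mxE.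
have HHE : \tr (H *m H) = \sum_p \sum_s H p s ^+ 2.
  apply: eq_bigr => p _; rewrite mxE; apply: eq_bigr => s _.
  by rewrite (HE s) expr2.
have S1 : sum3 (fun p q s => H p s ^+ 2 * w ord0 q ^+ 2) =
    \tr (H *m H) * (w *m w^T) ord0 ord0.
  rewrite wwE HHE mulr_suml; apply: eq_bigr => p _; rewrite mulr_sumr.
  by apply: eq_bigr => q _; rewrite mulr_suml.
have S2 : sum3 (fun p q s => H q s ^+ 2 * w ord0 p ^+ 2) =
    \tr (H *m H) * (w *m w^T) ord0 ord0.
  by rewrite -S1 /sum3 [LHS]exchange_big.
have S3 : sum3 (fun p q s => (w ord0 p * H p s) * (w ord0 q * H q s)) =
    (r *m r^T) ord0 ord0.
  rewrite rrE /sum3.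
  under eq_bigr => p _ do rewrite exchange_big.
  rewrite exchange_big; apply: eq_bigr => s _ /=.
  by rewrite rE expr2 mulr_suml; apply: eq_bigr => p _; rewrite mulr_sumr.
have S4 : sum3 (fun p q s => (q == s)%:R * r ord0 p ^+ 2) =
    n%:R * (r *m r^T) ord0 ord0.
  rewrite rrE mulr_sumr; apply: eq_bigr => p _.
  under eq_bigr => q _ do rewrite (sum_delta q (fun=> r ord0 p ^+ 2)).
  by rewrite sumr_const card_ord mulr_natl.
have S5 : sum3 (fun p q s => (p == s)%:R * r ord0 q ^+ 2) =
    n%:R * (r *m r^T) ord0 ord0.
  by rewrite -S4 /sum3 [LHS]exchange_big.
have S6 : sum3 (fun p q s => (q == s)%:R * ((p == s)%:R * (r ord0 p * r ord0 q))) =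
    (r *m r^T) ord0 ord0.
  rewrite rrE; apply: eq_bigr => p _.
  under eq_bigr => q _ do rewrite (sum_delta q (fun s => (p == s)%:R * _)).
  by rewrite (sum_delta p (fun q => r ord0 p * r ord0 q)) expr2.
have S7 : sum3 (fun p q s => (q == s)%:R * (w ord0 q * H p s * r ord0 p)) =
    (r *m r^T) ord0 ord0.
  rewrite rrE; apply: eq_bigr => p _.
  under eq_bigr => q _ do rewrite (sum_delta q (fun s => w ord0 q * H p s * _)).
  by rewrite -mulr_suml rE expr2; congr (_ * _); apply: eq_bigr => q _; rewrite HE.
have S8 : sum3 (fun p q s => (p == s)%:R * (w ord0 p * H q s * r ord0 q)) =
    (r *m r^T) ord0 ord0.
  by rewrite -S7 /sum3 [LHS]exchange_big.
have S9 : sum3 (fun p q s => (p == s)%:R * (H p s * (w ord0 q * r ord0 q))) = 0.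
  rewrite /sum3.
  under eq_bigr => p _ do under eq_bigr => q _ do
    rewrite (sum_delta p (fun s => H p s * _)).
  under eq_bigr => p _ do rewrite -mulr_sumr.
  by rewrite -mulr_suml -[X in X * _]/(\tr H) trH mul0r.
have S10 : sum3 (fun p q s => (q == s)%:R * (H q s * (w ord0 p * r ord0 p))) = 0.
  by rewrite -S9 /sum3 [LHS]exchange_big.
pose d (p q : 'I_n) : R := (p == q)%:R.
have dd p q : d p q * d p q = d p q by rewrite /d -natrM; case: eqP.
transitivity (sum3 (fun p q s =>
    al ^+ 2 * (H p s ^+ 2 * w ord0 q ^+ 2) + (al ^+ 2 * (H q s ^+ 2 * w ord0 p ^+ 2)
  + (- 2 * al ^+ 2 * ((w ord0 p * H p s) * (w ord0 q * H q s))
  + (ga ^+ 2 * (d q s * r ord0 p ^+ 2) + (ga ^+ 2 * (d p s * r ord0 q ^+ 2)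
  + (- 2 * ga ^+ 2 * (d q s * (d p s * (r ord0 p * r ord0 q)))
  + (- 2 * al * ga * (d q s * (w ord0 q * H p s * r ord0 p))
  + (- 2 * al * ga * (d p s * (w ord0 p * H q s * r ord0 q))
  + (2 * al * ga * (d p s * (H p s * (w ord0 q * r ord0 q)))
  + 2 * al * ga * (d q s * (H q s * (w ord0 p * r ord0 p))))))))))))).
  apply: eq_bigr => p _; apply: eq_bigr => q _; apply: eq_bigr => s _.
  rewrite -/(d q s) -/(d p s); move: (d q s) (d p s) (dd q s) (dd p s) => x y xx yy.
  apply/eqP; rewrite -subr_eq0; apply/eqP.
  (* To [ring] the Kronecker symbols x and y are free variables; up to their idempotence both sides
     agree, and this is the exact difference. *)
  transitivity (ga ^+ 2 * (r ord0 p ^+ 2 * (x * x - x) + r ord0 q ^+ 2 * (y * y - y))).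
    by ring.
  by rewrite xx yy !subrr !mulr0 addr0 mulr0.
rewrite !sum3D !sum3Z /d S1 S2 S3 S4 S5 S6 S7 S8 S9 S10.
by ring.
Qed.

End Contraction.

(** * The norm of a tensor of the shape of T for a general metric *)

Section TensorNorm.
Variables (R : rcfType) (n : nat).
Implicit Types (t : 'I_n -> 'I_n -> 'I_n -> R) (B M : 'M[R]_n) (z : 'rV[R]_n).

Lemma frame2E B M p s :
  (B^T *m M *m B) p s = \sum_i B i p * \sum_k M i k * B k s.
Proof.
rewrite -mulmxA mxE; apply: eq_bigr => i _; rewrite [B^T _ _]mxE.
by rewrite [(M *m B) _ _]mxE.
Qed.

Lemma frame3_13 B M z p q s :
  frame3 B (fun i j k => M i k * z ord0 j) p q s
  = (B^T *m M *m B) p s * (z *m B) ord0 q.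
Proof.
rewrite frame2E [(z *m B) _ _]mxE mulr_suml; apply: eq_bigr => i _.
rewrite -mulrA; congr (_ * _); rewrite mulr_sumr; apply: eq_bigr => j _.
by rewrite mulr_suml mulr_sumr; apply: eq_bigr => k _; ring.
Qed.

Lemma frame3_23 B M z p q s :
  frame3 B (fun i j k => M j k * z ord0 i) p q s
  = (B^T *m M *m B) q s * (z *m B) ord0 p.
Proof.
rewrite frame2E [(z *m B) _ _]mxE mulr_sumr; apply: eq_bigr => i _.
rewrite mulr_sumr mulr_suml; apply: eq_bigr => j _.
by rewrite !mulr_sumr !mulr_suml; apply: eq_bigr => k _; ring.
Qed.

Lemma frame3_lin B (f1 f2 f3 f4 : 'I_n -> 'I_n -> 'I_n -> R) (al ga : R) p q s :
  frame3 B (fun i j k => al * (f1 i j k - f2 i j k) - ga * (f3 i j k - f4 i j k)) p q s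
  = al * (frame3 B f1 p q s - frame3 B f2 p q s)
    - ga * (frame3 B f3 p q s - frame3 B f4 p q s).
Proof.
rewrite /frame3 -!sumrB !mulr_sumr -sumrB; apply: eq_bigr => i _.
rewrite -!mulrBr -!sumrB mulrCA [X in _ - X]mulrCA -mulrBr; congr (_ * _).
rewrite !mulr_sumr -sumrB; apply: eq_bigr => j _.
rewrite -!mulrBr -!sumrB mulrCA [X in _ - X]mulrCA -mulrBr; congr (_ * _).
rewrite !mulr_sumr -sumrB; apply: eq_bigr => k _.
by ring.
Qed.

(** Writing the inverse metric as B B^T gives a frame with B^T G B = 1. There G becomes the
    Kronecker symbol, N a sum of squares, and [orthonormal_T_norm] applies to B^T H B and w B. *)
Lemma T_norm (G H : 'M[R]_n) (w : 'rV[R]_n) (al ga : R) :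
  G^T = G -> (forall v : 'rV[R]_n, v != 0 -> 0 < (v *m G *m v^T) ord0 ord0) ->
  G \in unitmx -> H^T = H -> \tr (H *m invmx G) = 0 ->
  let r := w *m invmx G *m H in
  let t i j k := al * (H i k * w ord0 j - H j k * w ord0 i)
    - ga * (G j k * r ord0 i - G i k * r ord0 j) in
  let N := \sum_i \sum_j \sum_k \sum_a \sum_b \sum_c
    invmx G i a * invmx G j b * invmx G k c * t i j k * t a b c in
  0 <= N /\
  N = 2 * al ^+ 2 * (\tr (H *m invmx G *m (H *m invmx G))
        * (w *m invmx G *m w^T) ord0 ord0 - (r *m invmx G *m r^T) ord0 ord0)
    + (2 * (n%:R - 1) * ga ^+ 2 - 4 * al * ga) * (r *m invmx G *m r^T) ord0 ord0.
Proof.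
move=> symG posG unitG symH trH r t N.
have symP : (invmx G)^T = invmx G by rewrite trmx_inv symG.
have [B PE] : exists B : 'M[R]_n, invmx G = B *m B^T.
  apply: cholesky => // v v0.
  have vP0 : v *m invmx G != 0.
    by apply: contra_neq v0 => vP; rewrite -[v](mulmxKV unitG) vP mul0mx.
  by have := posG _ vP0; rewrite mulmxKV// trmx_mul symP mulmxA.
have unitB : B \in unitmx.
  have : invmx G \in unitmx by rewrite unitmx_inv.
  by rewrite PE unitmx_mul => /andP[].
have BGB : B^T *m G *m B = 1%:M.
  have E : G *m B *m B^T = 1%:M by rewrite -mulmxA -PE mulmxV.
  by rewrite -mulmxA; apply: mulmx1C.
have tE p q s : frame3 B t p q s =
   al * ((B^T *m H *m B) p s * (w *m B) ord0 q - (B^T *m H *m B) q s * (w *m B) ord0 p)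
   - ga * ((r *m B) ord0 p * (q == s)%:R - (r *m B) ord0 q * (p == s)%:R).
  rewrite /t frame3_lin frame3_13 frame3_23 frame3_23 frame3_13 BGB !mxE.
  by rewrite ![_%:R * _]mulrC.
have NE : N = sum3 (fun p q s => frame3 B t p q s ^+ 2) by exact: contract3.
split.
  rewrite NE; apply: sumr_ge0 => p _; apply: sumr_ge0 => q _.
  by apply: sumr_ge0 => s _; exact: sqr_ge0.
have rB : r *m B = w *m B *m (B^T *m H *m B) by rewrite /r PE !mulmxA.
have quad (z z' : 'rV[R]_n) : z *m invmx G *m z'^T = z *m B *m (z' *m B)^T.
  by rewrite PE trmx_mul !mulmxA.
rewrite NE; transitivity (sum3 (fun p q s =>
   (al * ((B^T *m H *m B) p s * (w *m B) ord0 q - (B^T *m H *m B) q s * (w *m B) ord0 p)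
   - ga * ((r *m B) ord0 p * (q == s)%:R - (r *m B) ord0 q * (p == s)%:R)) ^+ 2)).
  apply: eq_bigr => p _; apply: eq_bigr => q _; apply: eq_bigr => s _.
  by rewrite tE.
rewrite rB orthonormal_T_norm; first last.
- by rewrite -mulmxA mxtrace_mulC -mulmxA -PE.
- by rewrite !trmx_mul trmxK symH mulmxA.
rewrite -rB !quad; congr (2 * _ * (_ * _ - _) + _).
by rewrite PE !mulmxA [RHS]mxtrace_mulC !mulmxA.
Qed.

End TensorNorm.

(** * The static equations on an open coordinate set *)

Lemma posdef_unitmx (R : realFieldType) n (G : 'M[R]_n) :
  (forall v : 'rV[R]_n, v != 0 -> 0 < (v *m G *m v^T) ord0 ord0) -> G \in unitmx.
Proof.
move=> posG; rewrite -row_free_unit -kermx_eq0; apply/negPn/negP => /rowV0Pn[v].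
move=> /sub_kermxP vG v0.
by have := posG v v0; rewrite vG mul0mx mxE ltxx.
Qed.

(** U is an arbitrary open set, so that the record serves both for a whole chart codomain and for
    the overlap of two charts. *)
Record local_static (R : realType) (n : nat) (U : set 'rV[R]_n)
    (g : 'rV[R]_n -> 'M[R]_n) (u : 'rV[R]_n -> R) : Prop := LocalStatic {
  ls_open : open U;
  ls_metric : forall i j, smooth_on U (fun y => g y i j);
  ls_sym : forall x, U x -> (g x)^T = g x;
  ls_posdef : forall x, U x -> forall v : 'rV[R]_n, v != 0 ->
    0 < (v *m g x *m v^T) ord0 ord0;
  ls_smooth : smooth_on U u;
  ls_pos : forall x, U x -> 0 < u x;
  ls_hessian : forall x, U x -> forall i j,
    hessian g u i j x = u x * ricci_comp g i j x;
  ls_harmonic : forall x, U x -> laplacian g u x = 0 }.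

Definition sqnorm_grad (R : realType) n (g : 'rV[R]_n -> 'M[R]_n) u : 'rV[R]_n -> R :=
  gradprod g u u.

(** H g^-1 is the Hessian as an endomorphism; the trace of its square is the form in which Bochner's
    formula delivers |H|^2. *)
Definition sqnorm_hess (R : realType) n (g : 'rV[R]_n -> 'M[R]_n) u x : R :=
  \tr (hess_mx g u x *m invmx (g x) *m (hess_mx g u x *m invmx (g x))).

Section LocalStatic.
Variables (R : realType) (n : nat) (U : set 'rV[R]_n).
Variables (g : 'rV[R]_n -> 'M[R]_n) (u : 'rV[R]_n -> R).
Hypotheses (hn : (3 <= n)%N) (hs : local_static U g u).
Implicit Types x : 'rV[R]_n.

Let oU := ls_open hs.
Let sg := ls_metric hs.
Let symg := ls_sym hs.
Let su := ls_smooth hs.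
Local Notation W := (sqnorm_grad g u).
Local Notation hh := (sqnorm_hess g u).

Lemma ls_unit x : U x -> g x \in unitmx.
Proof. by move=> Ux; exact/posdef_unitmx/(ls_posdef hs). Qed.
Let unitg := ls_unit.

Lemma smooth_on_sqnorm_grad : smooth_on U W.
Proof. exact: smooth_on_gradprod. Qed.

Lemma gradprod_ge0 (a : 'rV[R]_n -> R) x : U x -> 0 <= gradprod g a a x.
Proof.
move=> Ux; rewrite -(inner_grad symg unitg)// /inner.
have [->|v0] := eqVneq (grad g a x) 0; first by rewrite !mul0mx mxE.
exact/ltW/(ls_posdef hs).
Qed.

Lemma gradprod_eq0 (a : 'rV[R]_n -> R) x : U x -> gradprod g a a x = 0 ->
  grad g a x = 0.
Proof.
move=> Ux; rewrite -(inner_grad symg unitg)// /inner => E.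
apply/eqP; apply: contra_eqT E => v0.
by rewrite gt_eqF//; exact: (ls_posdef hs).
Qed.

Lemma dcov_sqnorm_grad x : U x -> dcov W x = 2 *: (grad g u x *m hess_mx g u x).
Proof.
move=> Ux; rewrite (dcov_gradprod oU sg symg unitg su su Ux).
by rewrite scaler_nat mulr2n.
Qed.

Lemma gradprod_sqnorm_grad2 x : U x ->
  let r := grad g u x *m hess_mx g u x in
  gradprod g W W x = 4 * (r *m invmx (g x) *m r^T) ord0 ord0.
Proof.
move=> Ux r; rewrite /gradprod dcov_sqnorm_grad// linearZ /= -!scalemxAl -!scalemxAr.
by rewrite scalerA mxE -natrM.
Qed.

Lemma gradprod_sqnorm_grad x : U x ->
  gradprod g W u x = 2 * (grad g u x *m hess_mx g u x *m (grad g u x)^T) ord0 ord0.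
Proof.
move=> Ux; rewrite /gradprod dcov_sqnorm_grad// -!scalemxAl mxE -mulmxA.
congr (_ * (_ *m _) _ _).
by rewrite (gradE symg)// trmx_mul (invmx_sym symg).
Qed.

Lemma trace_hess x : U x -> \tr (hess_mx g u x *m invmx (g x)) = 0.
Proof.
move=> Ux; rewrite -(ls_harmonic hs Ux) /laplacian; apply: eq_bigr => i _.
rewrite mxE; apply: eq_bigr => j _.
by rewrite [hess_mx _ _ _ _ _]mxE (ginv_sym symg i j Ux) mulrC.
Qed.

Lemma bochner_static x : U x ->
  divergence g (fun y => grad g W y) x = 2 * hh x + gradprod g W u x / u x.
Proof.
move=> Ux; rewrite (divergence_nabla oU sg symg unitg su Ux) -addrA.
congr (_ + _).
(* The Laplacian vanishes on all of U, hence so do its partial derivatives. *)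
rewrite big1 ?mulr0 ?add0r => [|k _]; last first.
  rewrite (@pd_open_eq _ _ U _ (fun=> 0))//; last exact: (ls_harmonic hs).
  by rewrite pd_cst mulr0.
rewrite gradprod_sqnorm_grad// -mulrA; congr (2 * _).
rewrite /ricci [X in _ = X / _]mxE mulr_suml exchange_big; apply: eq_bigr => j _ /=.
rewrite [(_ *m hess_mx g u x) _ _]mxE [(grad g u x)^T _ _]mxE !mulr_suml.
apply: eq_bigr => i _.
rewrite [hess_mx _ _ _ _ _]mxE (ls_hessian hs)//.
by field; rewrite gt_eqF// (ls_pos hs).
Qed.

Lemma T_norm_static x : U x ->
  0 <= sqnorm3 g (Ttensor g u x) x /\
  (n%:R - 2) ^+ 2 * u x / (n%:R - 1) ^+ 2 * sqnorm3 g (Ttensor g u x) x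
  = (2 * W x * hh x - n%:R / (2 * (n%:R - 1)) * gradprod g W W x) / u x.
Proof.
move=> Ux.
have u0 : u x != 0 by rewrite gt_eqF// (ls_pos hs).
have n1 : n%:R - 1 != 0 :> R by rewrite subr_eq0 pnatr_eq1; case: (n) hn => [|[]].
have n2 : n%:R - 2 != 0 :> R.
  by rewrite subr_eq0 eqr_nat; case: (n) hn => [|[|[]]].
(* With Ric = H / u substituted, [al] and [ga] are the coefficients of the two brackets of T. *)
pose al : R := (n%:R - 1) / (n%:R - 2) / u x.
pose ga : R := (n%:R - 2)^-1 / u x.
pose w := dcov u x; pose r := w *m invmx (g x) *m hess_mx g u x.
have ricE i j : ricci_comp g i j x = hess_mx g u x i j / u x.
  by rewrite mxE (ls_hessian hs)// mulrC mulKf.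
have wE : grad g u x = w *m invmx (g x) by rewrite (gradE symg).
have ric_e i k : ricci g x (delta_mx ord0 i) (delta_mx ord0 k) =
    hess_mx g u x i k / u x.
  rewrite /ricci (bigD1 i)//= [X in _ + X]big1 => [|i' ii']; last first.
    by apply: big1 => j _; rewrite mxE (negbTE ii') andbF !mul0r.
  rewrite addr0 (bigD1 k)//= [X in _ + X]big1 => [|k' kk']; last first.
    by rewrite [delta_mx ord0 k _ _]mxE (negbTE kk') andbF mulr0 mul0r.
  by rewrite addr0 -ricE !mxE !eqxx /= !mul1r.
have ric_v i : ricci g x (delta_mx ord0 i) (grad g u x) = r ord0 i / u x.
  rewrite /ricci (bigD1 i)//= [X in _ + X]big1 => [|i' ii']; last first.
    by apply: big1 => j _; rewrite mxE (negbTE ii') andbF !mul0r.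
  rewrite addr0 /r -wE [in RHS]mxE mulr_suml; apply: eq_bigr => j _.
  rewrite [delta_mx _ _ _ _]mxE !eqxx mul1r ricE -mulrA; congr (_ * (_ / _)).
  by rewrite -{1}(hess_sym oU symg su Ux) mxE.
have in_e j k : inner g x (delta_mx ord0 j) (delta_mx ord0 k) = g x j k.
  by rewrite /inner -rowE trmx_delta -colE !mxE.
have wj j : w ord0 j = pd j u x by rewrite mxE.
have TE i j k : Ttensor g u x (delta_mx ord0 i) (delta_mx ord0 j) (delta_mx ord0 k)
   = al * (hess_mx g u x i k * w ord0 j - hess_mx g u x j k * w ord0 i)
     - ga * (g x j k * r ord0 i - g x i k * r ord0 j).
  rewrite /Ttensor !ric_e !ric_v !in_e -/(pd i u x) -/(pd j u x).
  rewrite !wj /al /ga; move: (hess_mx g u x i k) (hess_mx g u x j k).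
  move: (pd i u x) (pd j u x) (r ord0 i) (r ord0 j) (g x j k) (g x i k) => *.
  by field; rewrite u0 n2.
have := @T_norm R n (g x) (hess_mx g u x) w al ga (symg Ux) (ls_posdef hs Ux) (unitg Ux)
  (hess_sym oU symg su Ux) (trace_hess Ux).
rewrite -/r => -[N0 NE].
have SE := NE; rewrite -[LHS](_ : sqnorm3 g (Ttensor g u x) x = _) in SE; last first.
  do 3 (apply: eq_bigr => ? _); do 3 (apply: eq_bigr => ? _).
  by rewrite !TE.
split; first by rewrite SE -NE.
rewrite SE gradprod_sqnorm_grad2// wE -/r -/(hh x) -/(gradprod g u u x) -/(W x).
move: (hh x) (W x) ((r *m invmx (g x) *m r^T) ord0 ord0) => a b c.
by rewrite /al /ga; field; rewrite u0 n1 n2.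
Qed.

Lemma gradprod_sqnorm_grad2_le x : U x -> gradprod g W W x <= 4 * W x * hh x.
Proof.
move=> Ux; have [N0 NE] := T_norm_static Ux.
have u0 := ls_pos hs Ux.
have n3 : (3 : R) <= n%:R by rewrite (ler_nat R 3 n).
have : 0 <= (2 * W x * hh x - n%:R / (2 * (n%:R - 1)) * gradprod g W W x) / u x.
  rewrite -NE mulr_ge0// divr_ge0 ?sqr_ge0// mulr_ge0 ?sqr_ge0// ltW//.
rewrite pmulr_lge0 ?invr_gt0// subr_ge0 => H.
have G0 : 0 <= gradprod g W W x by exact: gradprod_ge0.
(* Since n / (n-1) >= 1, the coefficient of |grad W|^2 is at least 1/2. *)
have : 2^-1 * gradprod g W W x <= n%:R / (2 * (n%:R - 1)) * gradprod g W W x.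
  apply: ler_wpM2r => //.
  rewrite ler_pdivlMr; last by lra.
  by lra.
move=> /le_trans /(_ H); lra.
Qed.

End LocalStatic.

(** * Derivatives of the functions F and G *)

Section DerivativeRules.
Variables (R : realType) (V : normedModType R).
Implicit Types (f h : V -> R) (x v : V).

Lemma is_deriveM_fun f h x v (df dh : R) : is_derive x v f df ->
  is_derive x v h dh -> is_derive x v (fun y => f y * h y) (df * h x + f x * dh).
Proof.
move=> Df Dh; apply: (is_derive_eq (is_deriveM Df Dh)).
by rewrite addrC; congr (_ + _); exact: mulrC.
Qed.

Lemma is_deriveV_fun f x v (df : R) : f x != 0 -> is_derive x v f df ->
  is_derive x v (fun y => (f y)^-1) (- df / f x ^+ 2).
Proof.
move=> f0 [Df Ef]; split; first exact: derivableV.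
by rewrite deriveV// Ef /GRing.scale/= !mulNr mulrC.
Qed.

End DerivativeRules.

Section RobinsonFunctions.
Variables (R : realType) (n : nat).
Implicit Types (c d p t : R).

(** Near t the sign of 1 - s^2 is constant, so the absolute value is the polynomial [sg] (1 - s^2),
    and the power is taken at a positive base. *)
Lemma is_derive_absX (b t : R) : 1 - t ^+ 2 != 0 ->
  is_derive t 1 (fun s : R => `|1 - s ^+ 2| `^ b)
    (- 2 * b * t * `|1 - t ^+ 2| `^ b / (1 - t ^+ 2)).
Proof.
move=> t1; pose sg := Num.sg (1 - t ^+ 2).
have sg2 : sg * sg = 1 by rewrite -expr2 sqr_sg t1.
have abs_gt0 : 0 < `|1 - t ^+ 2| by rewrite normr_gt0.
have absE : `|1 - t ^+ 2| = sg * (1 - t ^+ 2) by rewrite normrEsg.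
have din : is_derive t 1 (fun s : R => sg * (1 - s ^+ 2)) (sg * (- 2 * t)).
  have dsq : is_derive t 1 (fun s : R => s * s) (1 * t + t * 1).
    by apply: is_deriveM_fun; exact: is_derive_id.
  have dB := is_deriveB (is_derive_cst (1 : R) t 1) dsq.
  have := is_deriveM_fun (is_derive_cst sg t 1) dB.
  by rewrite mul0r add0r => /is_derive_eq; apply; rewrite /cst; ring.
have dpow : is_derive (sg * (1 - t ^+ 2)) 1 (fun y => y `^ b)
    (b * (sg * (1 - t ^+ 2)) `^ (b - 1)).
  by rewrite -absE; exact: is_derive1_powR.
have near_t : \forall s \near t, (sg * (1 - s ^+ 2)) `^ b = `|1 - s ^+ 2| `^ b.
  have ct : {for t, continuous (fun s : R => sg * (1 - s ^+ 2))}.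
    by apply/differentiable_continuous/derivable1_diffP; case: din.
  have : \forall s \near t, 0 < sg * (1 - s ^+ 2).
    apply: (ct [set y | 0 < y]); apply: open_nbhs_nbhs.
    by split; [exact: open_gt|rewrite /= -absE].
  apply: filterS => s s0; congr (_ `^ _).
  have -> : 1 - s ^+ 2 = sg * (sg * (1 - s ^+ 2)) by rewrite mulrA sg2 mul1r.
  rewrite normrM (gtr0_norm s0) mulrA sg2 mul1r -[LHS]mul1r.
  by congr (_ * _); rewrite normr_sg t1.
apply: near_eq_is_derive near_t _.
apply: (is_derive_eq (is_derive_compR din dpow)).
have -> : (sg * (1 - t ^+ 2)) `^ (b - 1) = `|1 - t ^+ 2| `^ b / (sg * (1 - t ^+ 2)).
  rewrite -absE powRB; last by rewrite (gt_eqF abs_gt0) implybT.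
  by rewrite powRr1.
have sg0 : sg != 0 by rewrite sgr_eq0.
have sgV : sg^-1 = sg by apply: (mulfI sg0); rewrite mulfV.
move: (`|1 - t ^+ 2| `^ b) => E; rewrite invfM sgV.
transitivity ((sg * sg) * (- 2 * b * t * E / (1 - t ^+ 2))); first by ring.
by rewrite sg2 mul1r.
Qed.

(** The term with c stays separate because in F'/t + G (p-1)/2 it cancels against the second term of
    G. *)
Lemma is_derive_robF c d p t : 1 - t ^+ 2 != 0 ->
  is_derive t 1 (robF n c d p)
    (2 * t * (c / `|1 - t ^+ 2| `^ robinson_exp n p
              + robinson_exp n p * robF n c d p t / (1 - t ^+ 2))).
Proof.
move=> t1; rewrite /robF; move: (robinson_exp n p) => b.
have E0 : `|1 - t ^+ 2| `^ b != 0 by rewrite gt_eqF// powR_gt0// normr_gt0.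
have dnum : is_derive t 1 (fun s : R => c * s ^+ 2 + d) (c * (2 * t)).
  have dsq : is_derive t 1 (fun s : R => s * s) (1 * t + t * 1).
    by apply: is_deriveM_fun; exact: is_derive_id.
  have dM := is_deriveM_fun (is_derive_cst c t 1) dsq.
  apply: (is_derive_eq (is_deriveD dM (is_derive_cst d t 1))).
  by rewrite /cst; ring.
have := is_deriveM_fun dnum (is_deriveV_fun (f := fun s : R => `|1 - s ^+ 2| `^ b) E0
  (is_derive_absX b t1)).
move=> /is_derive_eq; apply; move: (`|1 - t ^+ 2| `^ b) E0 => E E0.
by field; rewrite E0 t1.
Qed.

(** The terms with c coming from the two summands of G cancel. What is left carries b (b+1) / (p-1),
    and the choice of b makes (b+1) / (p-1) equal to (n-1) / (n-2). *)
Lemma is_derive_robG c d p t : (3 <= n)%N -> p != 1 -> 1 - t ^+ 2 != 0 ->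
  is_derive t 1 (robG n c d p)
    (8 * robinson_exp n p * (n%:R - 1) / (n%:R - 2) * t * robF n c d p t
     / (1 - t ^+ 2) ^+ 2).
Proof.
move=> hn p1 t1.
have n2 : n%:R - 2 != 0 :> R.
  by rewrite subr_eq0 eqr_nat; case: (n) hn => [|[|[]]].
have p0 : p - 1 != 0 by rewrite subr_eq0.
have bE : robinson_exp n p = (n%:R - 1) * (p - 1) / (n%:R - 2) - 1 by [].
have dF := is_derive_robF c d p t1.
have dsub : is_derive t 1 (fun s : R => 1 - s ^+ 2) (- 2 * t).
  have dsq : is_derive t 1 (fun s : R => s * s) (1 * t + t * 1).
    by apply: is_deriveM_fun; exact: is_derive_id.
  apply: (is_derive_eq (is_deriveB (is_derive_cst (1 : R) t 1) dsq)).
  by rewrite /cst; ring.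
rewrite /robG; move: bE dF; move: (robF n c d p) (robinson_exp n p) => F b bE dF.
have E0 : `|1 - t ^+ 2| `^ b != 0 by rewrite gt_eqF// powR_gt0// normr_gt0.
have dE := is_derive_absX b t1.
have d1 := is_deriveM_fun (is_derive_cst (4 * b) t 1) dF.
have d2 := is_deriveM_fun (is_derive_cst (p - 1) t 1) dsub.
have d3 := is_deriveM_fun (is_derive_cst (p - 1) t 1) dE.
have q0 : (p - 1) * (1 - t ^+ 2) != 0 by rewrite mulf_neq0.
have q1 : (p - 1) * `|1 - t ^+ 2| `^ b != 0 by rewrite mulf_neq0.
have d4 := is_deriveM_fun d1 (is_deriveV_fun (f := fun s : R => (p - 1) * (1 - s ^+ 2)) q0 d2).
have d5 := is_deriveM_fun (is_derive_cst (4 * c) t 1) (is_deriveV_fun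
  (f := fun s : R => (p - 1) * `|1 - s ^+ 2| `^ b) q1 d3).
apply: (is_derive_eq (is_deriveB d4 d5)).
rewrite /cst; move: (`|1 - t ^+ 2| `^ b) (F t) E0 => E f E0.
rewrite bE; field; rewrite E0 t1 p0 n2.
by [].
Qed.

End RobinsonFunctions.

(** * The divergence of the Robinson field and the identity in one chart *)

Lemma divergence_lin (R : realType) n (g : 'rV[R]_n -> 'M[R]_n)
    (a b : 'rV[R]_n -> R) (X Y : 'rV[R]_n -> 'rV[R]_n) (x : 'rV[R]_n)
    (da db : 'I_n -> R) :
  (forall i, is_derive x (delta_mx ord0 i : 'rV[R]_n) a (da i)) ->
  (forall i, is_derive x (delta_mx ord0 i : 'rV[R]_n) b (db i)) ->
  (forall i, derivable (fun y => X y ord0 i) x (delta_mx ord0 i : 'rV[R]_n)) ->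
  (forall i, derivable (fun y => Y y ord0 i) x (delta_mx ord0 i : 'rV[R]_n)) ->
  divergence g (fun y => a y *: X y + b y *: Y y) x =
  \sum_i da i * X x ord0 i + a x * divergence g X x
  + (\sum_i db i * Y x ord0 i + b x * divergence g Y x).
Proof.
move=> Da Db dX dY; rewrite /divergence !mulr_sumr -!big_split.
apply: eq_bigr => i _ /=.
have pdE : pd i (fun y => (a y *: X y + b y *: Y y) ord0 i) x =
    da i * X x ord0 i + a x * pd i (fun y => X y ord0 i) x
    + (db i * Y x ord0 i + b x * pd i (fun y => Y y ord0 i) x).
  have -> : (fun y => (a y *: X y + b y *: Y y) ord0 i) =
      (fun y => a y * X y ord0 i + b y * Y y ord0 i).
    by apply/funext => y; rewrite !mxE.
  have d1 := is_deriveM_fun (Da i) (derivableP (dX i)).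
  have d2 := is_deriveM_fun (Db i) (derivableP (dY i)).
  by case: (is_deriveD d1 d2).
have sE : \sum_j christoffel g i i j x * (a x *: X x + b x *: Y x) ord0 j =
    a x * (\sum_j christoffel g i i j x * X x ord0 j)
    + b x * (\sum_j christoffel g i i j x * Y x ord0 j).
  rewrite !mulr_sumr -big_split; apply: eq_bigr => j _ /=.
  by rewrite !mxE; ring.
rewrite pdE sE.
by ring.
Qed.

Lemma divergence_near (R : realType) n (g : 'rV[R]_n -> 'M[R]_n)
    (U : set 'rV[R]_n) (X Y : 'rV[R]_n -> 'rV[R]_n) (x : 'rV[R]_n) :
  open U -> U x -> (forall y, U y -> X y = Y y) ->
  divergence g X x = divergence g Y x.
Proof.
move=> oU Ux XY; apply: eq_bigr => i _; rewrite XY//; congr (_ + _).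
by apply: (pd_open_eq _ oU Ux) => y /XY ->.
Qed.

Section RobinsonDivergence.
Variables (R : realType) (n : nat) (U : set 'rV[R]_n).
Variables (g : 'rV[R]_n -> 'M[R]_n) (u : 'rV[R]_n -> R).
Hypotheses (hn : (3 <= n)%N) (hs : local_static U g u)
  (hu : forall x, U x -> 1 - u x ^+ 2 != 0).
Variables (c d p : R).
Hypothesis hp : p != 1.
Implicit Types x : 'rV[R]_n.

Let oU := ls_open hs.
Let sg := ls_metric hs.
Let symg := ls_sym hs.
Let unitg := ls_unit hs.
Let su := ls_smooth hs.
Local Notation W := (sqnorm_grad g u).
Local Notation hh := (sqnorm_hess g u).
Local Notation be := (robinson_exp n p).
Local Notation F := (robF n c d p).
Local Notation G := (robG n c d p).
Local Notation N := (norm_grad g u).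

Lemma norm_gradE x : U x -> N x = Num.sqrt (W x).
Proof. by move=> Ux; rewrite /norm_grad /sqnorm (inner_grad symg unitg). Qed.

Lemma norm_grad_sq x : U x -> N x ^+ 2 = W x.
Proof. by move=> Ux; rewrite norm_gradE// sqr_sqrtr// (gradprod_ge0 hs). Qed.

Lemma grad_norm_sq x : U x -> grad g (fun y => N y ^+ 2) x = grad g W x.
Proof.
move=> Ux; apply/rowP => i; rewrite !mxE; apply: eq_bigr => j _; congr (_ * _).
by apply: (pd_open_eq _ oU Ux) => y; exact: norm_grad_sq.
Qed.

(** N^q is handled as W^(q/2), where W is smooth on U and positive at x. *)
Lemma is_derive_norm_grad_pow q x i : U x -> 0 < W x ->
  is_derive x (delta_mx ord0 i : 'rV[R]_n) (fun y => N y `^ q)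
    (q / 2 * N x `^ q / W x * pd i W x).
Proof.
move=> Ux W0.
have NE y : U y -> W y `^ (2^-1 * q) = N y `^ q.
  by move=> Uy; rewrite norm_gradE// -powR12_sqrt ?(gradprod_ge0 hs)// -powRrM.
have dW : is_derive x (delta_mx ord0 i : 'rV[R]_n) W (pd i W x).
  by apply: derivableP; exact: smooth_on_derivable (smooth_on_sqnorm_grad hs) Ux.
have dp := is_derive1_powR (2^-1 * q) W0.
apply: near_eq_is_derive (is_derive_eq (is_derive_comp1 dW dp) _).
  exact: near_open NE.
rewrite powRB ?(gt_eqF W0) ?implybT// powRr1 ?(ltW W0)// NE//.
by rewrite mulrA [q / 2]mulrC.
Qed.

(* At critical points [gradprod g W W x / W x] is the junk value [0 / 0 = 0]. *)
Definition robinson_div x : R :=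
  N x `^ (p - 3) * F (u x) *
  (2 * hh x / u x + (p - 3) / (2 * u x) * (gradprod g W W x / W x)
   + 4 * be * gradprod g W u x / (1 - u x ^+ 2)
   + 8 * be * (n%:R - 1) / (n%:R - 2) * u x * W x ^+ 2 / (1 - u x ^+ 2) ^+ 2).

Lemma divergence_robinson x : U x -> 0 < W x ->
  divergence g (robinson_field g u c d p) x = robinson_div x.
Proof.
move=> Ux W0.
have u0 : u x != 0 by rewrite gt_eqF// (ls_pos hs).
have t1 := hu Ux.
have n2 : n%:R - 2 != 0 :> R.
  by rewrite subr_eq0 eqr_nat; case: (n) hn => [|[|[]]].
have p0 : p - 1 != 0 by rewrite subr_eq0.
have du i : is_derive x (delta_mx ord0 i : 'rV[R]_n) u (pd i u x).
  by apply: derivableP; exact: smooth_on_derivable su Ux.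
have dF i := is_derive_comp1 (du i) (is_derive_robF n c d p t1).
have dG i := is_derive_comp1 (du i) (is_derive_robG c d hn hp t1).
have da i := is_deriveM_fun (is_deriveM_fun (dF i) (is_deriveV_fun u0 (du i)))
  (is_derive_norm_grad_pow (p - 3) i Ux W0).
have db i := is_deriveM_fun (dG i) (is_derive_norm_grad_pow (p - 1) i Ux W0).
have dX i : derivable (fun y => grad g W y ord0 i) x (delta_mx ord0 i : 'rV[R]_n).
  exact: smooth_on_derivable (smooth_on_grad oU sg unitg i (smooth_on_sqnorm_grad hs)) Ux.
have dY i : derivable (fun y => grad g u y ord0 i) x (delta_mx ord0 i : 'rV[R]_n).
  exact: smooth_on_derivable (smooth_on_grad oU sg unitg i su) Ux.
(* The divergence of a gradient is the trace of [covd], which is the Laplacian. *)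
have divu : divergence g (fun y => grad g u y) x = 0.
  rewrite -(ls_harmonic hs Ux) /laplacian; apply: eq_bigr => i _.
  rewrite -[LHS]/(covd g u i i x) (covdE oU sg symg unitg _ _ su Ux) mxE.
  by apply: eq_bigr => j _; rewrite [hess_mx _ _ _ _ _]mxE (ginv_sym symg i j Ux) mulrC.
have lin (a b : R) (h : 'rV[R]_n -> R) :
    \sum_i (a * pd i u x + b * pd i W x) * grad g h x ord0 i =
    a * gradprod g u h x + b * gradprod g W h x.
  rewrite !(gradprod_sum _ _ _ Ux) !mulr_sumr -big_split; apply: eq_bigr => i _ /=.
  by ring.
have N0 : N x != 0.
  by rewrite norm_gradE// gt_eqF// sqrtr_gt0.
have Npow : N x `^ (p - 1) = N x `^ (p - 3) * W x.
  rewrite -norm_grad_sq// -powR_mulrn ?sqrtr_ge0// -powRD ?N0 ?implybT//.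
  by congr (_ `^ _); ring.
have E y : U y -> robinson_field g u c d p y =
    (F (u y) / u y * N y `^ (p - 3)) *: grad g W y
    + (G (u y) * N y `^ (p - 1)) *: grad g u y.
  by move=> Uy; rewrite /robinson_field grad_norm_sq.
rewrite (divergence_near g oU Ux E).
rewrite (divergence_lin g da db dX dY) (bochner_static hs Ux) divu.
pose E0 := `|1 - u x ^+ 2| `^ be.
have E00 : E0 != 0 by rewrite gt_eqF// powR_gt0// normr_gt0.
(* [F1] and [G1] are F' and G' at u x. [A1], [A2] are the coefficients of du and dW in the
   differential of F(u)/u N^(p-3), and [B1], [B2] those for G(u) N^(p-1). *)
pose F1 := 2 * u x * (c / E0 + be * F (u x) / (1 - u x ^+ 2)).
pose G1 := 8 * be * (n%:R - 1) / (n%:R - 2) * u x * F (u x) / (1 - u x ^+ 2) ^+ 2.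
pose A1 := (F1 / u x - F (u x) / u x ^+ 2) * N x `^ (p - 3).
pose A2 := F (u x) / u x * ((p - 3) / 2 * N x `^ (p - 3) / W x).
pose B1 := G1 * N x `^ (p - 1).
pose B2 := G (u x) * ((p - 1) / 2 * N x `^ (p - 1) / W x).
transitivity (A1 * gradprod g u W x + A2 * gradprod g W W x
  + F (u x) / u x * N x `^ (p - 3) * (2 * hh x + gradprod g W u x / u x)
  + (B1 * gradprod g u u x + B2 * gradprod g W u x)).
  rewrite mulr0 addr0 -(lin A1 A2 W) -(lin B1 B2 u).
  congr (_ + _ + _).
    apply: eq_bigr => i _; congr (_ * _).
    rewrite /A1 /A2 -/E0 -/F1; move: (pd i u x) (pd i W x) => du' dW'.
    have w0 : W x != 0 by rewrite gt_eqF.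
    move: (F1) (N x `^ (p - 3)) (F (u x)) (W x) w0 => F2 Np f w w0.
    by field; rewrite u0 w0.
  apply: eq_bigr => i _; congr (_ * _).
  rewrite /B1 /B2 -/G1; move: (pd i u x) (pd i W x) => du' dW'.
  by rewrite !mulrA; congr (_ + _); rewrite mulrAC.
rewrite (gradprodC symg u W Ux) -[gradprod g u u x]/(W x) /robinson_div.
rewrite /A1 /A2 /B1 /B2 /F1 /G1 Npow /robG -/E0 => {A1 A2 B1 B2 F1 G1}.
have w0 : W x != 0 by rewrite gt_eqF.
move: (gradprod g W u x) (gradprod g W W x) (W x) (hh x) (N x `^ (p - 3)) w0.
move: E0 E00 (be) (F (u x)) => e e0 b f S S2 w h Np w0.
by field; rewrite u0 t1 n2 p0 e0 w0.
Qed.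

(** At a critical point grad W = 2 H (grad u) = 0. This keeps the identity true where the quotient
    in [robinson_div] is a default value. *)
Lemma sqnorm_grad_eq0_critical x : U x -> W x = 0 -> gradprod g W W x = 0.
Proof.
move=> Ux W0; rewrite (gradprod_sqnorm_grad2 hs Ux) (gradprod_eq0 hs Ux W0).
by rewrite !mul0mx mxE mulr0.
Qed.

Lemma sqnormD_scale x (k : R) (v w : 'rV[R]_n) : U x ->
  sqnorm g x (v + k *: w) =
  sqnorm g x v + 2 * k * inner g x v w + k ^+ 2 * sqnorm g x w.
Proof.
move=> Ux; rewrite /sqnorm.
have C : inner g x w v = inner g x v w.
  by rewrite /inner trmx_entry !trmx_mul trmxK symg// mulmxA.
have -> : inner g x (v + k *: w) (v + k *: w) =
    inner g x v v + k * inner g x v w + (k * inner g x w v + k * (k * inner g x w w)).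
  have M : (v + k *: w) *m g x *m (v + k *: w)^T = v *m g x *m v^T
      + k *: (v *m g x *m w^T) + (k *: (w *m g x *m v^T) + k *: (k *: (w *m g x *m w^T))).
    by rewrite linearD linearZ /= !mulmxDl !mulmxDr -!scalemxAr -!scalemxAl.
  rewrite /inner M; clear M.
  move: (v *m g x *m v^T) (v *m g x *m w^T) (w *m g x *m v^T) (w *m g x *m w^T).
  by move=> *; rewrite !mxE.
by rewrite C; ring.
Qed.

Lemma robinson_rhsE x : U x ->
  N x ^+ 2 * robinson_div x = robinson_rhs g u c d p x.
Proof.
move=> Ux.
have u0 : u x != 0 by rewrite gt_eqF// (ls_pos hs).
have t1 := hu Ux.
have n1 : n%:R - 1 != 0 :> R by rewrite subr_eq0 pnatr_eq1; case: (n) hn => [|[]].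
have n2 : n%:R - 2 != 0 :> R.
  by rewrite subr_eq0 eqr_nat; case: (n) hn => [|[|[]]].
rewrite /robinson_rhs (T_norm_static hn hs Ux).2 grad_norm_sq// norm_grad_sq//.
rewrite sqnormD_scale// /sqnorm !(inner_grad symg unitg)//.
rewrite -[gradprod g u u x]/(W x) /robinson_div.
(* If W x = 0, the quotient and |grad W|^2 are both 0, so W cancels at every point, critical or
   not. *)
have Q : W x * (gradprod g W W x / W x) = gradprod g W W x.
  have [W0|W0] := eqVneq (W x) 0; last by rewrite mulrCA mulfV// mulr1.
  by rewrite W0 mul0r sqnorm_grad_eq0_critical.
(* As a multiple of p - p_n, the exponent exposes the mixed and the last term of the completed
   square. *)
have beE : be = (n%:R - 1) * (p - p_ n) / (n%:R - 2).
  by rewrite /robinson_exp /p_; field; rewrite n1 n2.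
have pE : p_ n = 2 - (n%:R - 1)^-1 :> R by [].
move: Q; rewrite beE pE.
move: (gradprod g W u x) (hh x) (F (u x)) (N x `^ (p - 3)) => S h f Np.
move: (W x) (gradprod g W W x) (gradprod g W W x / W x) => w WW q <-.
by field; rewrite u0 t1 n1 n2.
Qed.

End RobinsonDivergence.

(** * Continuity of the divergence expression across critical points *)

(** For q = 0 the convention that 0 to the power 0 is 1 makes the function constant. For q > 0 it
    factors through |z| to the power q, which is continuous at 0 from both sides whatever [powR]
    does at negative bases. *)
Lemma sqrt_powR_continuous (R : realType) (q : R) : 0 <= q ->
  continuous (fun w : R => Num.sqrt w `^ q).
Proof.
move=> q0 w.
have [->|qn0] := eqVneq q 0.
  have -> : (fun w : R => Num.sqrt w `^ 0) = fun=> 1.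
    by apply/funext => y; rewrite powRr0.
  exact: cst_continuous.
have {qn0}q0 : 0 < q by rewrite lt_neqAle eq_sym qn0.
have pow_cont (y : R) : 0 <= y -> {for y, continuous (fun z : R => `|z| `^ q)}.
  rewrite le_eqVlt => /predU1P[<-|y0].
    apply/cvgrPdist_lt => e e0; rewrite normr0 powR0 ?gt_eqF//.
    have r0 : 0 < e `^ q^-1 by rewrite powR_gt0.
    have near0 : \forall z \near (0 : R), `|z| < e `^ q^-1.
      by apply: filterS (nbhsx_ballx (0 : R) _ r0) => z; rewrite /ball/= sub0r normrN.
    apply: filterS near0 => z z1.
    rewrite sub0r normrN ger0_norm ?powR_ge0//.
    have : `|z| `^ q < (e `^ q^-1) `^ q.
      by apply: gt0_ltr_powR; rewrite ?nnegrE ?normr_ge0 ?ltW.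
    by rewrite -powRrM mulVf ?gt_eqF// powRr1// ltW.
  have C : {for y, continuous (fun z : R => z `^ q)}.
    by apply/differentiable_continuous/derivable1_diffP; case: (is_derive1_powR q y0).
  have near_y : \forall z \near y, z `^ q = `|z| `^ q.
    have : \forall z \near y, 0 < z by exact: lt_nbhsr.
    by apply: filterS => z z0; rewrite gtr0_norm.
  move: C; rewrite /prop_for /continuous_at (gtr0_norm y0) => C.
  by apply: cvg_trans C; apply: near_eq_cvg.
have -> : (fun w : R => Num.sqrt w `^ q) = (fun z => `|z| `^ q) \o Num.sqrt.
  by apply/funext => y /=; rewrite ger0_norm ?sqrtr_ge0.
by apply: continuous_comp; [exact: sqrt_continuous|apply: pow_cont; exact: sqrtr_ge0].
Qed.

Lemma continuous_squeeze0 (R : realType) (T : topologicalType) (f h : T -> R)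
    (x : T) : h x = 0 -> f x = 0 -> (\forall y \near x, 0 <= f y <= h y) ->
  {for x, continuous h} -> {for x, continuous f}.
Proof.
move=> hx fx fh; rewrite /prop_for /continuous_at hx fx => /cvgrPdist_lt ch.
apply/cvgrPdist_lt => e e0; apply: filterS2 fh (ch e e0) => y /andP[f0 fh].
rewrite !sub0r !normrN (ger0_norm f0) => he.
exact: le_lt_trans fh (le_lt_trans (ler_norm _) he).
Qed.

Section RobinsonContinuity.
Variables (R : realType) (n : nat) (U : set 'rV[R]_n).
Variables (g : 'rV[R]_n -> 'M[R]_n) (u : 'rV[R]_n -> R).
Hypotheses (hn : (3 <= n)%N) (hs : local_static U g u)
  (hu : forall x, U x -> 1 - u x ^+ 2 != 0).
Variables (c d p : R).
Implicit Types x : 'rV[R]_n.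

Let oU := ls_open hs.
Let sg := ls_metric hs.
Let symg := ls_sym hs.
Let unitg := ls_unit hs.
Let su := ls_smooth hs.
Local Notation W := (sqnorm_grad g u).
Local Notation hh := (sqnorm_hess g u).
Local Notation be := (robinson_exp n p).
Local Notation F := (robF n c d p).
Local Notation N := (norm_grad g u).

Lemma smooth_on_sqnorm_hess : smooth_on U hh.
Proof.
have E x : U x -> \sum_i \sum_k covd g u i k x * covd g u k i x = hh x.
  by move=> Ux; rewrite /sqnorm_hess (trace_covd oU sg symg unitg su Ux).
have sc k i := smooth_on_covd oU sg unitg k i su.
exact: (smooth_on_eq oU E (smooth_on_sum xpredT oU (fun i =>
  smooth_on_sum xpredT oU (fun k => smooth_onM oU (sc i k) (sc k i))))).
Qed.

Lemma continuous_norm_grad_pow q x : 0 <= q -> U x ->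
  {for x, continuous (fun y => N y `^ q)}.
Proof.
move=> q0 Ux.
have cW : {for x, continuous W} by exact: smooth_on_continuous (smooth_on_sqnorm_grad hs) Ux.
have E y : U y -> ((fun w : R => Num.sqrt w `^ q) \o W) y = N y `^ q.
  by move=> Uy; rewrite /= (norm_gradE hs).
have C := continuous_comp cW (@sqrt_powR_continuous R q q0 (W x)).
exact: (continuous_open_eq oU Ux E C).
Qed.

(** Where W vanishes, the bound |grad W|^2 <= 4 W |H|^2 squeezes the function between 0 and 4
    N^(p-3) |H|^2, which tends to 0 because p > 3. *)
Lemma continuous_gradient_quotient x : 3 < p -> U x ->
  {for x, continuous (fun y => N y `^ (p - 3) * (gradprod g W W y / W y))}.
Proof.
move=> p3 Ux.
have q0 : 0 < p - 3 by rewrite subr_gt0.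
have cN : {for x, continuous (fun y => N y `^ (p - 3))}.
  by apply: continuous_norm_grad_pow => //; exact: ltW.
have sW := smooth_on_sqnorm_grad hs.
have cW : {for x, continuous W} by exact: smooth_on_continuous sW Ux.
have cWW : {for x, continuous (gradprod g W W)}.
  exact: smooth_on_continuous (smooth_on_gradprod oU sg unitg sW sW) Ux.
have [W0|W0] := eqVneq (W x) 0; last first.
  apply: continuousM cN _; apply: continuousM cWW _; exact: continuousV cW.
have Nx0 : N x `^ (p - 3) = 0.
  by rewrite (norm_gradE hs)// W0 sqrtr0 powR0// gt_eqF.
have ch : {for x, continuous (fun y => N y `^ (p - 3) * (4 * hh y))}.
  apply: continuousM cN _; apply: continuousM; first exact: cst_continuous.
  exact: smooth_on_continuous smooth_on_sqnorm_hess Ux.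
apply: (continuous_squeeze0 _ _ _ ch); [by rewrite Nx0 mul0r..|].
apply: (near_open oU Ux) => y Uy.
have Np : 0 <= N y `^ (p - 3) by exact: powR_ge0.
have W_ge0 : 0 <= W y := gradprod_ge0 hs u Uy.
have WW_ge0 : 0 <= gradprod g W W y := gradprod_ge0 hs W Uy.
rewrite mulr_ge0 ?divr_ge0//=.
have [Wy0|Wy0] := eqVneq (W y) 0.
  by rewrite (norm_gradE hs)// Wy0 sqrtr0 powR0 ?mul0r// gt_eqF.
rewrite ler_wpM2l// ler_pdivrMr; last by rewrite lt_neqAle eq_sym Wy0.
by have := gradprod_sqnorm_grad2_le hn hs Uy; rewrite mulrAC.
Qed.

Lemma continuous_robinson_div x : 3 <= p -> U x ->
  {for x, continuous (robinson_div g u c d p)}.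
Proof.
move=> p3 Ux.
have u0 : u x != 0 by rewrite gt_eqF// (ls_pos hs).
have t1 := hu Ux.
have t2 : (1 - u x ^+ 2) ^+ 2 != 0 by rewrite expf_neq0.
have sW := smooth_on_sqnorm_grad hs.
have cN : {for x, continuous (fun y => N y `^ (p - 3))}.
  by apply: continuous_norm_grad_pow => //; rewrite subr_ge0.
have cu : {for x, continuous u} by exact: smooth_on_continuous su Ux.
have cW : {for x, continuous W} by exact: smooth_on_continuous sW Ux.
have cS : {for x, continuous (gradprod g W u)}.
  exact: smooth_on_continuous (smooth_on_gradprod oU sg unitg sW su) Ux.
have ch : {for x, continuous hh}.
  exact: smooth_on_continuous smooth_on_sqnorm_hess Ux.
have cF : {for x, continuous (fun y => F (u y))}.
  apply: (continuous_comp cu).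
  by apply/differentiable_continuous/derivable1_diffP; case: (is_derive_robF n c d p t1).
have cc (a : R) : {for x, continuous (fun=> a : R)} by exact: cst_continuous.
have cu2 : {for x, continuous (fun y => 1 - u y ^+ 2)}.
  by apply: continuousB (cc 1) _; exact: (continuousM cu cu).
have cu4 : {for x, continuous (fun y => (1 - u y ^+ 2) ^+ 2)}.
  exact: (continuousM cu2 cu2).
have cVu : {for x, continuous (fun y => (u y)^-1)} by exact: continuousV.
have cV2 : {for x, continuous (fun y => (1 - u y ^+ 2)^-1)}.
  by apply: continuousV; [exact: t1|exact: cu2].
have cV4 : {for x, continuous (fun y => ((1 - u y ^+ 2) ^+ 2)^-1)}.
  by apply: continuousV; [exact: t2|exact: cu4].
have cA : {for x, continuous (fun y => 2 * hh y / u y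
   + 4 * be * gradprod g W u y / (1 - u y ^+ 2)
   + 8 * be * (n%:R - 1) / (n%:R - 2) * u y * W y ^+ 2 / (1 - u y ^+ 2) ^+ 2)}.
  apply: continuousD; first apply: continuousD.
  - exact: (continuousM (continuousM (cc 2) ch) cVu).
  - exact: (continuousM (continuousM (cc (4 * be)) cS) cV2).
  - exact: (continuousM (continuousM (continuousM
      (cc (8 * be * (n%:R - 1) / (n%:R - 2))) cu) (continuousM cW cW))
      cV4).
(* The singular summand is split off from the rest; [alg] puts the two pieces together again. *)
have cB : {for x, continuous (fun y => (p - 3) / 2 * F (u y) / u y *
    (N y `^ (p - 3) * (gradprod g W W y / W y)))}.
  (* At p = 3 the power of N does not decay, but the coefficient p - 3 removes the quotient
     altogether. *)
  move: p3; rewrite le_eqVlt => /predU1P[p3|p3].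
    have -> : (fun y => (p - 3) / 2 * F (u y) / u y *
      (N y `^ (p - 3) * (gradprod g W W y / W y))) = fun=> 0.
      by apply/funext => y; rewrite -p3 subrr !mul0r.
    exact: cc.
  apply: continuousM; last exact: continuous_gradient_quotient.
  exact: (continuousM (continuousM (cc ((p - 3) / 2)) cF) cVu).
have := continuousD (continuousM (continuousM cN cF) cA) cB.
have alg (Np f a b e q v : R) : v != 0 ->
    Np * f * (a + b + e) + (p - 3) / 2 * f / v * (Np * q) =
    Np * f * (a + (p - 3) / (2 * v) * q + b + e).
  by move=> v0; field; rewrite v0.
apply: (continuous_open_eq oU Ux) => y Uy.
by apply: alg; rewrite gt_eqF// (ls_pos hs).
Qed.

End RobinsonContinuity.

(** * Invariance under change of coordinates *)

Lemma gradprod_near (R : realType) n (U : set 'rV[R]_n) (g : 'rV[R]_n -> 'M[R]_n)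
    (a a' b b' : 'rV[R]_n -> R) x : open U -> U x ->
  (forall y, U y -> a y = a' y) -> (forall y, U y -> b y = b' y) ->
  gradprod g a b x = gradprod g a' b' x.
Proof.
move=> oU Ux aa bb.
have E (h h' : 'rV[R]_n -> R) : (forall y, U y -> h y = h' y) -> dcov h x = dcov h' x.
  by move=> hh; apply/rowP => i; rewrite !mxE; exact: pd_open_eq hh.
by rewrite /gradprod (E a a' aa) (E b b' bb).
Qed.

Section ChangeOfCoordinates.
Variables (R : realType) (n : nat) (O V : set 'rV[R]_n).
Variables (g g' : 'rV[R]_n -> 'M[R]_n) (tau : 'rV[R]_n -> 'rV[R]_n).
Variables (u u' : 'rV[R]_n -> R).
Hypotheses (hs : local_static O g u) (hs' : local_static V g' u').
Hypotheses (tauV : forall x, O x -> V (tau x))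
  (stau : forall r, smooth_on O (fun x => tau x ord0 r))
  (g_tau : forall x, O x -> forall a b : 'I_n, g x a b =
      \sum_r \sum_s pd a (fun y => tau y ord0 r) x
        * pd b (fun y => tau y ord0 s) x * g' (tau x) r s)
  (u_tau : forall x, O x -> u x = u' (tau x)).
Implicit Types (a b : 'rV[R]_n -> R) (x : 'rV[R]_n).

Let oO := ls_open hs.
Let oV := ls_open hs'.

Definition jac x : 'M[R]_n := \matrix_(a, r) pd a (fun y => tau y ord0 r) x.

Lemma metric_jac x : O x -> g x = jac x *m g' (tau x) *m (jac x)^T.
Proof.
move=> Ox; apply/matrixP => a b; rewrite g_tau// exchange_big [RHS]mxE.
apply: eq_bigr => s _; rewrite [(_ *m g' _) _ _]mxE mulr_suml.
by apply: eq_bigr => r _; rewrite !mxE; ring.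
Qed.

(** From g = J g' J^T, the matrices J g' and J^T g^-1 are inverse to each other; multiplying them in
    the other order gives the claim. *)
Lemma invmx_jac x : O x ->
  (jac x)^T *m invmx (g x) *m jac x = invmx (g' (tau x)).
Proof.
move=> Ox; have ug := ls_unit hs Ox; have ug' := ls_unit hs' (tauV Ox).
have uJ : jac x \in unitmx.
  by move: ug; rewrite metric_jac// !unitmx_mul => /andP[/andP[]].
have uJT : (jac x)^T \in unitmx by rewrite unitmx_tr.
have E : jac x *m g' (tau x) *m ((jac x)^T *m invmx (g x)) = 1%:M.
  by rewrite mulmxA -metric_jac// mulmxV.
have E2 : (jac x)^T *m invmx (g x) *m jac x *m g' (tau x) = 1%:M.
  by rewrite -mulmxA; exact: mulmx1C.
by rewrite -[LHS](mulmxK ug') E2 mul1mx.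
Qed.

Lemma dcov_tau a x : smooth_on V a -> O x ->
  dcov (fun y => a (tau y)) x = dcov a (tau x) *m (jac x)^T.
Proof.
move=> sa Ox; apply/rowP => i; rewrite !mxE.
have dt r := smooth_on_derivable (i := i) (stau r) Ox.
case: (is_derive_comp_smooth oV sa (tauV Ox) dt) => _; rewrite /pd => ->.
by apply: eq_bigr => r _; rewrite !mxE mulrC.
Qed.

Lemma gradprod_tau a b x : smooth_on V a -> smooth_on V b -> O x ->
  gradprod g (fun y => a (tau y)) (fun y => b (tau y)) x = gradprod g' a b (tau x).
Proof.
move=> sa sb Ox; rewrite /gradprod !dcov_tau// -invmx_jac// trmx_mul trmxK.
by rewrite !mulmxA.
Qed.

(** Phrased for functions that correspond under [tau] on all of O, so that it applies again to
    products of gradients, which correspond by the lemma itself. *)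
Lemma gradprod_change a a' b b' x : smooth_on V a' -> smooth_on V b' ->
  (forall y, O y -> a y = a' (tau y)) -> (forall y, O y -> b y = b' (tau y)) ->
  O x -> gradprod g a b x = gradprod g' a' b' (tau x).
Proof.
move=> sa sb aa bb Ox; rewrite -gradprod_tau//.
exact: (gradprod_near g oO Ox aa bb).
Qed.

Lemma sqnorm_grad_change x : O x -> sqnorm_grad g u x = sqnorm_grad g' u' (tau x).
Proof. exact: gradprod_change (ls_smooth hs') (ls_smooth hs') u_tau u_tau. Qed.

Lemma dcov_coord (r : 'I_n) x : dcov (fun y => y ord0 r) x = delta_mx ord0 r.
Proof.
apply/rowP => i; rewrite mxE.
case: (is_derive_coord r x (delta_mx ord0 i)) => _; rewrite /pd => ->.
by rewrite !mxE !eqxx eq_sym.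
Qed.

(* Polarizing the first order invariant [gradprod] along the coordinate
   functions of the second chart yields all components of the Hessian. *)
Lemma hess_change x : O x ->
  (jac x)^T *m (invmx (g x) *m hess_mx g u x *m invmx (g x)) *m jac x =
  invmx (g' (tau x)) *m hess_mx g' u' (tau x) *m invmx (g' (tau x)).
Proof.
move=> Ox; apply/matrixP => r s.
have symg := ls_sym hs; have symg' := ls_sym hs'.
have sg := ls_metric hs; have sg' := ls_metric hs'.
have su := ls_smooth hs; have su' := ls_smooth hs'.
have ug := ls_unit hs; have ug' := ls_unit hs'.
pose y_ (r : 'I_n) := fun y : 'rV[R]_n => y ord0 r.
pose t_ (r : 'I_n) := fun y : 'rV[R]_n => tau y ord0 r.
have sy r' : smooth_on V (y_ r') by exact: smooth_on_coord.
have st r' : smooth_on O (t_ r') by exact: stau.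
have ty r' y : O y -> t_ r' y = y_ r' (tau y) by [].
have Vx := tauV Ox.
have H1 := hess_gradprod oO sg symg ug (st r) (st s) su Ox.
have H2 := hess_gradprod oV sg' symg' ug' (sy r) (sy s) su' Vx.
have E1 r' s' y : O y -> gradprod g (t_ r') (t_ s') y = gradprod g' (y_ r') (y_ s') (tau y).
  exact: gradprod_change (sy r') (sy s') (ty r') (ty s').
have E2 r' y : O y -> gradprod g (t_ r') u y = gradprod g' (y_ r') u' (tau y).
  exact: gradprod_change (sy r') su' (ty r') u_tau.
have S1 r' s' : smooth_on V (gradprod g' (y_ r') (y_ s')).
  exact: (smooth_on_gradprod oV sg' ug' (sy r') (sy s')).
have S2 r' : smooth_on V (gradprod g' (y_ r') u').
  exact: (smooth_on_gradprod oV sg' ug' (sy r') su').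
(* Second use of the first order invariance, now with a [gradprod] as one argument: the three terms
   on the right of [hess_gradprod] agree in both charts. *)
have F1 := gradprod_change (sy r) (S2 s) (ty r) (E2 s) Ox.
have F2 := gradprod_change (sy s) (S2 r) (ty s) (E2 r) Ox.
have F3 := gradprod_change su' (S1 r s) u_tau (E1 r s) Ox.
have entry (M : 'M[R]_n) (w w' : 'rV[R]_n) (B : 'M[R]_n) :
    w = row r B -> w' = row s B -> (w *m M *m w'^T) ord0 ord0 = (B *m M *m B^T) r s.
  move=> -> ->; rewrite -row_mul tr_row !mxE; apply: eq_bigr => j _.
  by rewrite !mxE.
have G1 r' : grad g (t_ r') x = row r' ((jac x)^T *m invmx (g x)).
  have dt : dcov (t_ r') x = row r' (jac x)^T.
    by apply/rowP => j; rewrite !mxE.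
  by rewrite (gradE symg (t_ r') Ox) dt row_mul.
have G2 r' : grad g' (y_ r') (tau x) = row r' (invmx (g' (tau x))).
  by rewrite (gradE symg' (y_ r') Vx) dcov_coord -rowE.
move: H1; rewrite (entry _ _ _ _ (G1 r) (G1 s)) F1 F2 F3 -H2.
rewrite (entry _ _ _ _ (G2 r) (G2 s)) (invmx_sym symg' Vx).
by rewrite trmx_mul trmxK (invmx_sym symg Ox) !mulmxA.
Qed.

Lemma sqnorm_hess_change x : O x -> sqnorm_hess g u x = sqnorm_hess g' u' (tau x).
Proof.
move=> Ox; rewrite /sqnorm_hess.
have ug := ls_unit hs Ox; have ug' := ls_unit hs' (tauV Ox).
move: (hess_change Ox) ug ug' (metric_jac Ox).
move: (g' (tau x)) (hess_mx g' u' (tau x)) (hess_mx g u x) (g x) (jac x).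
move=> G' H' H G J E ug ug' GE.
(* B A^-1 = A Q, where Q is the Hessian B with both indices raised. [hess_change] transforms Q, and
   the Jacobian factors are moved to their places by cyclicity of the trace. *)
have K (A B : 'M[R]_n) : A \in unitmx ->
    \tr (B *m invmx A *m (B *m invmx A)) =
    \tr (A *m (invmx A *m B *m invmx A) *m (A *m (invmx A *m B *m invmx A))).
  by move=> uA; rewrite !mulmxA mulmxV// mul1mx -!mulmxA !(mulmxA A) mulmxV// mul1mx.
rewrite (K _ _ ug) (K _ _ ug') -E.
move: (invmx G *m H *m invmx G) => Q; rewrite GE.
by rewrite !mulmxA [RHS]mxtrace_mulC !mulmxA.
Qed.

Lemma robinson_div_change (c d p : R) x : O x ->
  robinson_div g u c d p x = robinson_div g' u' c d p (tau x).
Proof.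
move=> Ox.
have sW' := smooth_on_sqnorm_grad hs'; have su' := ls_smooth hs'.
rewrite /robinson_div (norm_gradE hs Ox) (norm_gradE hs' (tauV Ox)).
rewrite (u_tau Ox) (sqnorm_hess_change Ox) (sqnorm_grad_change Ox).
rewrite (gradprod_change sW' sW' sqnorm_grad_change sqnorm_grad_change Ox).
by rewrite (gradprod_change sW' su' sqnorm_grad_change u_tau Ox).
Qed.

End ChangeOfCoordinates.

(** * From charts to the manifold *)

Section Charts.
Variables (R : realType) (n : nat) (M : manifold R n).
Implicit Types (k : chart R n M) (q : M).

Lemma chart_continuous_at k q : chart_dom k q -> {for q, continuous (chart_map k)}.
Proof.
move=> kq; have := @chart_map_continuous R n M k.
by rewrite (continuous_open_subspace _ (@chart_dom_open R n M k)) => /(_ q); apply; rewrite inE.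
Qed.

Lemma chart_inv_continuous_at k x : chart_cod k x ->
  {for x, continuous (chart_inv k)}.
Proof.
move=> kx; have := @chart_inv_continuous R n M k.
by rewrite (continuous_open_subspace _ (@chart_cod_open R n M k)) => /(_ x); apply; rewrite inE.
Qed.

Lemma overlap_open k k' : open (overlap k k').
Proof.
rewrite openE => x [kx k'x]; rewrite /interior.
apply: filterI.
  exact: open_nbhs_nbhs (conj (@chart_cod_open R n M k) kx).
apply: (chart_inv_continuous_at kx).
exact: open_nbhs_nbhs (conj (@chart_dom_open R n M k') k'x).
Qed.

Lemma transition_cod k k' x : overlap k k' x -> chart_cod k' (transition k k' x).
Proof. by move=> [_ k'x]; exact: chart_map_cod. Qed.

Variables (g : riem_metric M) (f : M -> R).
Hypothesis hsv : static_vacuum g f.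

Lemma local_static_chart k (U : set 'rV[R]_n) : atlas k -> open U ->
  U `<=` chart_cod k -> local_static U (g k) (f \o chart_inv k).
Proof.
move=> ak oU Uk; split => //.
- by move=> i j; exact: smooth_on_subset Uk (gmx_smooth g ak i j).
- by move=> x /Uk kx; exact: gmx_sym.
- by move=> x /Uk kx; exact: gmx_posdef.
- exact: smooth_on_subset Uk (sv_smooth hsv ak).
- by move=> x _; exact: sv_pos hsv _.
- by move=> x /Uk kx i j; exact: sv_hessian.
- by move=> x /Uk kx; exact: sv_harmonic.
Qed.

Lemma robinson_div_chart (c d p : R) k k' q : atlas k -> atlas k' ->
  chart_dom k q -> chart_dom k' q ->
  robinson_div (g k) (f \o chart_inv k) c d p (chart_map k q) =
  robinson_div (g k') (f \o chart_inv k') c d p (chart_map k' q).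
Proof.
move=> ak ak' kq k'q.
(* The first chart is restricted to the overlap, the domain of the transition map; the second one
   keeps its whole codomain. *)
have hs := local_static_chart ak (@overlap_open k k') (fun x Hx => proj1 Hx).
have hs' := local_static_chart ak' (@chart_cod_open R n M k') (fun x => id).
have Ox : overlap k k' (chart_map k q).
  by split; [exact: chart_map_cod|rewrite chart_mapK].
have u_tau x : overlap k k' x ->
    (f \o chart_inv k) x = (f \o chart_inv k') (transition k k' x).
  by move=> [kx k'x]; rewrite /= /transition chart_mapK.
rewrite (robinson_div_change hs hs' (@transition_cod k k') (atlas_smooth ak ak')
  (fun x Hx => gmx_transition g ak ak' Hx) u_tau c d p Ox).
by rewrite /transition chart_mapK.
Qed.

End Charts.

Theorem theorem1p5 (R : realType) (n : nat) (hn : (3 <= n)%N)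
    (M : manifold R n) (g : riem_metric M) (f : M -> R)
    (hsv : static_vacuum g f)
    (hf : (forall q : M, 0 < f q < 1) \/ (forall q : M, 1 < f q))
    (c d p : R) (hp : p != 1) :
  [/\ forall (k : chart R n M) (q : M), atlas k -> chart_dom k q -> ~ Crit g f q ->
        let u := f \o chart_inv k in
        let x := chart_map k q in
        norm_grad (g k) u x ^+ 2
          * divergence (g k) (robinson_field (g k) u c d p) x
        = robinson_rhs (g k) u c d p x,
      3 <= p ->
        exists D : M -> R,
          [/\ continuous D,
              forall (k : chart R n M) (q : M),
                atlas k -> chart_dom k q -> ~ Crit g f q ->
                D q = divergence (g k)
                        (robinson_field (g k) (f \o chart_inv k) c d p)
                        (chart_map k q)
            & forall (k : chart R n M) (q : M), atlas k -> chart_dom k q ->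
                let u := f \o chart_inv k in
                let x := chart_map k q in
                norm_grad (g k) u x ^+ 2 * D q
                = robinson_rhs (g k) u c d p x]
    & p_ n <= p ->
        forall (k : chart R n M) (q : M), atlas k -> chart_dom k q ->
        ~ Crit g f q -> 0 <= robF n c d p (f q) ->
        0 <= divergence (g k)
               (robinson_field (g k) (f \o chart_inv k) c d p) (chart_map k q)].
Proof.
have hs (k : chart R n M) (ak : atlas k) :
    local_static (chart_cod k) (g k) (f \o chart_inv k).
  exact: local_static_chart hsv _ _ ak (@chart_cod_open R n M k) (fun x => id).
have hu (k : chart R n M) (x : 'rV[R]_n) : chart_cod k x ->
    1 - (f \o chart_inv k) x ^+ 2 != 0.
  move=> _ /=; move: (chart_inv k x) => q; case: hf => /(_ q).
    move=> /andP[f0 f1]; rewrite gt_eqF// subr_gt0 expr_lt1//; exact: ltW.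
  move=> f1; rewrite lt_eqF// subr_lt0 expr_gt1//; exact: ltW (lt_trans ltr01 f1).
(* [Crit] asks for one chart in which the gradient vanishes, so W = 0 in the chart at hand already
   makes q critical. *)
have W_gt0 (k : chart R n M) (q : M) (ak : atlas k) (kq : chart_dom k q) :
    ~ Crit g f q -> 0 < sqnorm_grad (g k) (f \o chart_inv k) (chart_map k q).
  move=> nC; have kx := chart_map_cod kq.
  rewrite lt_neqAle (gradprod_ge0 (hs k ak) _ kx) andbT eq_sym; apply/eqP => W0.
  by apply: nC; exists k; split=> //; rewrite (norm_gradE (hs k ak) kx) W0 sqrtr0.
have divE (k : chart R n M) (q : M) (ak : atlas k) (kq : chart_dom k q)
    (nC : ~ Crit g f q) :=
  divergence_robinson hn (hs k ak) (hu k) c d hp (chart_map_cod kq) (W_gt0 k q ak kq nC).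
have rhsE (k : chart R n M) (q : M) (ak : atlas k) (kq : chart_dom k q) :=
  robinson_rhsE hn (hs k ak) (hu k) c d p (chart_map_cod kq).
split.
- by move=> k q ak kq nC u x; rewrite /u /x divE//; exact: rhsE.
- move=> p3.
  (* The extension D is evaluated in a chosen chart around each point; independence of the choice
     gives [DE], hence continuity in any fixed chart. *)
  have chartOf q : {k : chart R n M | atlas k /\ chart_dom k q}.
    by apply: cid; have [k ak kq] := atlas_cover q; exists k.
  pose D q := let k := sval (chartOf q) in
    robinson_div (g k) (f \o chart_inv k) c d p (chart_map k q).
  have DE (k : chart R n M) (q : M) : atlas k -> chart_dom k q ->
      D q = robinson_div (g k) (f \o chart_inv k) c d p (chart_map k q).
    move=> ak kq; rewrite /D; case: (chartOf q) => k0 [ak0 k0q] /=.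
    exact: robinson_div_chart.
  exists D; split.
  + move=> q; have [k ak kq] := atlas_cover q.
    have cD := continuous_comp (chart_continuous_at kq)
      (@continuous_robinson_div R n _ _ _ hn (hs k ak) (hu k) c d p _ p3
        (chart_map_cod kq)).
    have near_q : \forall y \near q,
        (robinson_div (g k) (f \o chart_inv k) c d p \o chart_map k) y = D y.
      apply: filterS (open_nbhs_nbhs (conj (@chart_dom_open R n M k) kq)) => y ky.
      by rewrite (DE k y ak ky).
    rewrite /continuous_at (DE k q ak kq).
    exact: cvg_trans (near_eq_cvg near_q) cD.
  + by move=> k q ak kq nC; rewrite (DE k q ak kq) divE.
  + by move=> k q ak kq u x; rewrite (DE k q ak kq); exact: rhsE.
- move=> pn k q ak kq nC F0.
  have kx := chart_map_cod kq.
  have W0 := W_gt0 k q ak kq nC.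
  rewrite divE//; have E := rhsE k q ak kq.
  (* Multiplying by W > 0 keeps the sign and turns the divergence into the right-hand side of the
     identity, whose terms are all nonnegative for p >= p_n. *)
  rewrite -(pmulr_rge0 _ W0) -(norm_grad_sq (hs k ak) kx) E.
  rewrite /robinson_rhs mulr_ge0//.
    by rewrite mulr_ge0 ?powR_ge0//= chart_mapK.
  have u0 := ls_pos (hs k ak) kx.
  rewrite addr_ge0//.
    rewrite mulr_ge0 ?(T_norm_static hn (hs k ak) kx).1//.
    by rewrite divr_ge0 ?sqr_ge0// mulr_ge0 ?sqr_ge0// ltW.
  rewrite mulr_ge0//.
    by rewrite divr_ge0 ?subr_ge0// mulr_ge0// ltW.
  rewrite /sqnorm /inner; set v := (X in (X *m _) *m _).
  have [->|v0] := eqVneq v 0; first by rewrite !mul0mx mxE.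
  by apply: ltW; exact: (ls_posdef (hs k ak) kx).
Qed.
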